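(* For an abelian group $X$ the following conditions are equivalent: (1) each minimal left ideal of $\lambda(X)$ is metrizable; (2) the family $\widehat{\mathcal K}$ of maximal 2-cogroups of $X$ is at most countable; (3) the group $X$ admits no epimorphism onto the group $C_{2^\infty}\oplus C_{2^\infty}$ and $X$ has finite ranks $r_0(X)$ and $r_2(X)$.
   Context: Superextension. $\mathsf P(X)$ is the power-set of $X$. A family $\mathcal L\subset\mathsf P(X)$ is linked if $A\cap B\ne\emptyset$ for all $A,B\in\mathcal L$, and maximal linked if it is linked and coincides with every linked family containing it. $\lambda(X)\subset\mathsf P(\mathsf P(X))$ is the set of maximal linked systems on $X$, with the subspace topology of $\mathsf P(\mathsf P(X))\cong\{0,1\}^{\mathsf P(X)}$ and the operation $\mathcal A\circ\mathcal B=\{A\subset X:\{x\in X:x^{-1}A\in\mathcal B\}\in\mathcal A\}$; it is a compact Hausdorff right-topological semigroup. A nonempty subset $K\subset X$ is a 2-cogroup if for every $x\in K$ the shift $xK=Kx$ is a subgroup of $X$ disjoint from $K$; $\widehat{\mathcal K}$ is the set of inclusion-maximal 2-cogroups. $C_{2^\infty}=\bigcup_{k\ge 1}\{z\in\mathbb C:z^{2^k}=1\}$ is the quasicyclic 2-group. A subset $A\not\ni e$ of an abelian group $G$ with neutral element $e$ is independent if for any disjoint $B,C\subset A$ the subgroups generated by $B$ and $C$ intersect in the trivial subgroup. The free rank $r_0(G)$ (resp. the 2-rank $r_2(G)$) is the cardinality of a maximal independent subset of $G$ consisting of elements of infinite order (resp. of elements whose order is a power of 2). *)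

(* Defs.v *)
From HB Require Import structures.
From mathcomp Require Import all_boot all_order all_algebra.
From mathcomp Require Import all_classical all_reals all_analysis.
From mathcomp.real_closed Require Import complex.

Set Implicit Arguments.
Unset Strict Implicit.
Unset Printing Implicit Defensive.

Import Order.TTheory GRing.Theory Num.Theory.

Local Open Scope classical_set_scope.
Local Open Scope ring_scope.

Definition metrizable (R : realType) (T : topologicalType) : Prop :=
  exists d : T -> T -> R,
    [/\ forall x y, 0 <= d x y,
        forall x y, d x y = 0 <-> x = y,
        forall x y, d x y = d y x,
        forall x y z, d x z <= d x y + d y z
      & nbhs_ball_ (fun x e => [set y | d x y < e]) = nbhs :> (T -> set_system T)].

(** The space P(P(X)): families of subsets of [X], topologized through their
    characteristic functions, as the Cantor cube {0,1}^P(X). *)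
Definition PPX (X : Type) : Type := set (set X).

Definition char_fun (X : Type) (L : PPX X) :
    prod_topology (fun _ : set X => bool) :=
  fun A => `[< L A >].

HB.instance Definition _ (X : Type) :=
  Topological.copy (PPX X)
    (initial_topology (@char_fun X : set (set X) -> _)).

Definition linked (X : Type) (L : PPX X) : Prop :=
  forall A B, L A -> L B -> A `&` B !=set0.

Definition maximal_linked (X : Type) (L : PPX X) : Prop :=
  linked L /\ forall M : PPX X, linked M -> L `<=` M -> M = L.

Definition superextension (X : Type) : set (PPX X) :=
  [set L | maximal_linked L].

(** Groups are written additively. The inner set [[set y | A (x + y)]] is the
    shift of [A] by the inverse of [x]. *)
Definition circ (X : zmodType) (L M : PPX X) : PPX X :=
  [set A | L [set x | M [set y | A (x + y)]]].

Section Ideals.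
Variables (T : Type) (S : set T) (op : T -> T -> T).

Definition left_ideal (I : set T) : Prop :=
  [/\ I `<=` S, I !=set0 & forall a b, S a -> I b -> I (op a b)].

Definition minimal_left_ideal (I : set T) : Prop :=
  left_ideal I /\ forall J, left_ideal J -> J `<=` I -> J = I.

End Ideals.

Section AbelianGroup.
Variable X : zmodType.

Definition subgroup (H : set X) : Prop := zmod_closed [in H].

Definition generated (B : set X) : set X := smallest subgroup B.

Definition two_cogroup (K : set X) : Prop :=
  K !=set0 /\
  forall x, K x ->
    subgroup [set x + y | y in K] /\ [set x + y | y in K] `&` K = set0.

Definition maximal_two_cogroups : set (set X) :=
  [set K | two_cogroup K /\ forall L, two_cogroup L -> K `<=` L -> L = K].

Definition independent (A : set X) : Prop :=
  ~ A 0 /\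
  forall B C, B `<=` A -> C `<=` A -> B `&` C = set0 ->
    generated B `&` generated C = [set 0].

Definition has_order (x : X) (n : nat) : Prop :=
  [/\ (0 < n)%N, x *+ n = 0 & forall m, (0 < m)%N -> x *+ m = 0 -> (n <= m)%N].

Definition infinite_order : set X := [set x | forall n, ~ has_order x n].

Definition two_power_order : set X :=
  [set x | exists k, has_order x (2 ^ k)%N].

Definition maximal_independent_in (E A : set X) : Prop :=
  [/\ A `<=` E, independent A
    & forall B, B `<=` E -> independent B -> A `<=` B -> B = A].

(** All maximal independent subsets of [infinite_order], resp. of
    [two_power_order], have the same cardinality, called the rank; so the
    rank is finite as soon as one of them is finite. *)
Definition finite_free_rank : Prop :=
  exists2 A, maximal_independent_in infinite_order A & finite_set A.

Definition finite_two_rank : Prop :=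
  exists2 A, maximal_independent_in two_power_order A & finite_set A.

End AbelianGroup.

(** The group law of the quasicyclic 2-group is the multiplication of complex
    numbers; it is registered as the addition of a [zmodType]. *)
Section Quasicyclic.
Variable R : realType.

Definition in_quasicyclic2 (z : R[i]) : bool :=
  `[< exists2 k, (1 <= k)%N & z ^+ (2 ^ k)%N = 1 >].

Record quasicyclic2 : Type := Quasicyclic2 {
  qc2_val :> R[i];
  qc2_valP : in_quasicyclic2 qc2_val }.

HB.instance Definition _ := [isSub for qc2_val].
HB.instance Definition _ := [Choice of quasicyclic2 by <:].

Lemma qc2_one_subproof : in_quasicyclic2 1.
Proof. by apply/asboolP; exists 1%N => //; rewrite expr1n. Qed.

Lemma qc2_mul_subproof (x y : quasicyclic2) :
  in_quasicyclic2 (qc2_val x * qc2_val y).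
Proof.
case: x y => [x /asboolP[k k1 xk]] [y /asboolP[l l1 yl]] /=.
apply/asboolP; exists (k + l)%N; first by rewrite addn_gt0 k1.
by rewrite exprMn {1}expnD exprM xk expr1n mul1r addnC expnD exprM yl expr1n.
Qed.

Lemma qc2_inv_subproof (x : quasicyclic2) : in_quasicyclic2 (qc2_val x)^-1.
Proof.
case: x => [x /asboolP[k k1 xk]] /=.
by apply/asboolP; exists k; rewrite // exprVn xk invr1.
Qed.

Definition qc2_one := Quasicyclic2 qc2_one_subproof.
Definition qc2_mul x y := Quasicyclic2 (qc2_mul_subproof x y).
Definition qc2_inv x := Quasicyclic2 (qc2_inv_subproof x).

Lemma qc2_mulA : associative qc2_mul.
Proof. by move=> x y z; apply: val_inj; rewrite /= mulrA. Qed.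

Lemma qc2_mulC : commutative qc2_mul.
Proof. by move=> x y; apply: val_inj; rewrite /= mulrC. Qed.

Lemma qc2_mul1 : left_id qc2_one qc2_mul.
Proof. by move=> x; apply: val_inj; rewrite /= mul1r. Qed.

Lemma qc2_mulV : left_inverse qc2_one qc2_inv qc2_mul.
Proof.
move=> [x xP]; apply: val_inj; rewrite /= mulVf //.
move/asboolP: xP => [k _ xk]; apply/negP => /eqP x0.
by move/eqP: xk; rewrite x0 expr0n expn_eq0 /= eq_sym oner_eq0.
Qed.

HB.instance Definition _ :=
  GRing.isZmodule.Build quasicyclic2 qc2_mulA qc2_mulC qc2_mul1 qc2_mulV.

End Quasicyclic.

(* Main.v *)
Require Import Defs.
From HB Require Import structures.
From mathcomp Require Import all_boot all_order all_algebra.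
From mathcomp Require Import all_classical all_reals all_analysis.
From mathcomp.real_closed Require Import complex.
From mathcomp Require Import zify.

(** The operation of [lambda(X)] is composition of functions: a maximal linked
    system [L] acts on [P(X)] by [phi L A = {x | x^-1 A \in L}], and the
    functions so obtained are exactly the equivariant, monotone ones that
    commute with complements.  In an abelian group such functions can be
    prescribed freely on one twin set ([k A = X \ A] for some [k]) per maximal
    2-cogroup, and can be made to take values in the orbits of these sets, [set0]
    and [setT].  A minimal left ideal is therefore determined by one orbit per
    maximal 2-cogroup [K]; the orbit is countable since [X / (K + K)] is a cyclic
    or quasicyclic 2-group.  Hence countably many maximal 2-cogroups give a
    countable base, while a maximal 2-cogroup not seen by a countable family of
    coordinates can be altered without moving a given point of the ideal.

    A maximal 2-cogroup is the same as a subgroup [N] with [X / N] a nontrivial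
    cyclic or quasicyclic 2-group.  Infinite ranks, or an epimorphism onto the
    square of the quasicyclic group, yield [2^omega] 2-cogroups, no two of them
    inside a common 2-cogroup.  Conversely, if two such [N] with infinite
    quotients satisfy [N + N' = X], then [X] maps onto the square of the
    quasicyclic group; otherwise all these [N] are commensurable, and finiteness
    of the ranks leaves only countably many. *)

Set Implicit Arguments.
Unset Strict Implicit.
Unset Printing Implicit Defensive.

Import Order.TTheory GRing.Theory Num.Theory.

Local Open Scope classical_set_scope.
Local Open Scope ring_scope.

(** Identities of abelian groups, decided by comparing integer coefficients; the
    [ring] tactic does not apply to a [zmodType]. *)
Inductive zexp :=
  | ZVar of nat | ZZero | ZAdd of zexp & zexp | ZOpp of zexp
  | ZDbl of zexp.

Fixpoint zeval (V : zmodType) (env : seq V) (e : zexp) : V :=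
  match e with
  | ZVar i => env`_i
  | ZZero => 0
  | ZAdd a b => zeval env a + zeval env b
  | ZOpp a => - zeval env a
  | ZDbl a => zeval env a *+ 2
  end.

Fixpoint zcoef (e : zexp) (i : nat) : int :=
  match e with
  | ZVar j => (i == j)%:Z
  | ZZero => 0
  | ZAdd a b => zcoef a i + zcoef b i
  | ZOpp a => - zcoef a i
  | ZDbl a => zcoef a i * 2
  end.

Lemma zeval_sum (V : zmodType) (env : seq V) e :
  zeval env e = \sum_(i < size env) env`_i *~ zcoef e i.
Proof.
elim: e => [j| |a IHa b IHb|a IHa|a IHa] /=; rewrite ?IHa ?IHb.
- have [ltj|gej] := ltnP j (size env).
    rewrite (bigD1 (Ordinal ltj)) //= eqxx mulr1z big1 ?addr0 // => i.
    by rewrite -val_eqE /= => /negbTE ->.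
  rewrite nth_default // big1 // => i _.
  by rewrite (ltn_eqF (leq_trans (ltn_ord i) gej)).
- by rewrite big1.
- by rewrite -big_split; apply: eq_bigr => i _; rewrite mulrzDr.
- by rewrite -sumrN; apply: eq_bigr => i _; rewrite mulrNz.
- by rewrite -sumrMnl; apply: eq_bigr => i _; rewrite mulrzA.
Qed.

Lemma zeval_eq (V : zmodType) (env : seq V) e1 e2 :
  all (fun i => zcoef e1 i == zcoef e2 i) (iota 0 (size env)) ->
  zeval env e1 = zeval env e2.
Proof.
move=> /allP e12; rewrite !zeval_sum; apply: eq_bigr => i _; congr (_ *~ _).
by apply/eqP/e12; rewrite mem_iota /= ltn_ord.
Qed.

Ltac zmem x l :=
  lazymatch l with
  | nil => constr:(false)
  | cons x _ => constr:(true)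
  | cons _ ?l' => zmem x l'
  end.

Ltac zenv t l :=
  lazymatch t with
  | (?a + ?b)%R => let l1 := zenv a l in zenv b l1
  | (- ?a)%R => zenv a l
  | (0)%R => l
  | (?a *+ 2)%R => zenv a l
  | ?x => lazymatch zmem x l with
          | true => l
          | false => constr:(cons x l)
          end
  end.

Ltac zindex x l :=
  lazymatch l with
  | cons x _ => constr:(O)
  | cons _ ?l' => let n := zindex x l' in constr:(S n)
  end.

Ltac zreify t l :=
  lazymatch t with
  | (?a + ?b)%R =>
      let a' := zreify a l in let b' := zreify b l in constr:(ZAdd a' b')
  | (- ?a)%R => let a' := zreify a l in constr:(ZOpp a')
  | (0)%R => constr:(ZZero)
  | (?a *+ 2)%R => let a' := zreify a l in constr:(ZDbl a')
  | ?x => let n := zindex x l in constr:(ZVar n)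
  end.

Ltac zmod :=
  lazymatch goal with
  | |- @eq ?V ?x ?y =>
      let l := zenv x (@nil V) in let l := zenv y l in
      let a := zreify x l in let b := zreify y l in
      exact: (@zeval_eq _ l a b isT)
  end.

(** * 2-cogroups *)

Section Subgroups.
Variable X : zmodType.
Implicit Types (A H K L N U W : set X) (x y z a b c : X).

Lemma subgroupP H :
  subgroup H <-> H 0 /\ forall x y, H x -> H y -> H (x - y).
Proof.
split=> [[h0 hB]|[h0 hB]].
  by split=> [|x y hx hy]; [have := h0 | have := hB x y]; rewrite !inE; exact.
by split=> [|x y]; rewrite !inE // => hx hy; exact: hB.
Qed.

Lemma subgroup0 H : subgroup H -> H 0.
Proof. by case/subgroupP. Qed.

Lemma subgroupB H x y : subgroup H -> H x -> H y -> H (x - y).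
Proof. by case/subgroupP=> _; exact. Qed.

Lemma subgroupN H x : subgroup H -> H x -> H (- x).
Proof. by move=> hH hx; rewrite -sub0r; apply: subgroupB => //; case/subgroupP: hH. Qed.

Lemma subgroupD H x y : subgroup H -> H x -> H y -> H (x + y).
Proof. by move=> hH hx hy; rewrite -[y]opprK; apply: subgroupB => //; exact: subgroupN. Qed.

Lemma subgroupMn H x n : subgroup H -> H x -> H (x *+ n).
Proof.
move=> hH hx; elim: n => [|n IH]; first by rewrite mulr0n; exact: subgroup0.
by rewrite mulrS; exact: subgroupD.
Qed.

Lemma subgroupMz H x m : subgroup H -> H x -> H (x *~ m).
Proof.
move=> hH hx; case: m => n; first exact: subgroupMn.
by rewrite NegzE mulrNz; apply: subgroupN => //; exact: subgroupMn.
Qed.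

Lemma subgroupDl H x y : subgroup H -> H x -> H (x + y) <-> H y.
Proof.
move=> hH hx; split=> [hxy|hy]; last exact: subgroupD.
have -> : y = x + y - x by zmod.
exact: subgroupB.
Qed.

(** A set [K] is a 2-cogroup when [K `|` (K + K)] is a subgroup in which
    [K + K] has index two. *)
Lemma two_cogroupP K :
  two_cogroup K <->
  [/\ K !=set0, forall a, K a -> K (- a),
      forall a b c, K a -> K b -> K c -> K (a + b + c)
    & forall a b, K a -> K b -> ~ K (a + b)].
Proof.
split=> [[K0 hK]|[K0 KN KD3 KD]].
  split=> // [a Ka|a b c Ka Kb Kc|a b Ka Kb Kab].
  - have [/subgroup0[y Ky ay0] _] := hK a Ka.
    by have -> : - a = y by rewrite -[y](addKr a) ay0 addr0.
  - have [sg _] := hK a Ka.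
    have [||y Ky E] := subgroupD (x := a + b) (y := a + c) sg; [by exists b|by exists c|].
    suff -> : a + b + c = y by [].
    by apply: (@addrI _ a); rewrite E; zmod.
  have [_] := hK a Ka; rewrite -subset0 => /(_ (a + b)); apply.
  by split=> //; exists b.
split=> // x Kx; split.
  apply/subgroupP; split; first by exists (- x); [exact: KN|rewrite subrr].
  move=> _ _ [a Ka <-] [b Kb <-]; exists (a - b - x); last by zmod.
  by apply: KD3 => //; exact: KN.
by rewrite -subset0 => _ [[y Ky <-]]; exact: KD.
Qed.

Definition cobase K : set X := [set x | exists a b, [/\ K a, K b & x = a + b]].

Section Cogroup.
Variable K : set X.
Hypothesis cK : two_cogroup K.

Lemma cogroupN a : K a -> K (- a).
Proof. by case/two_cogroupP: cK => _ + _ _; exact. Qed.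

Lemma cogroup_ex : exists a, K a. Proof. by case: cK. Qed.

Lemma cobaseP a x : K a -> cobase K x <-> K (a + x).
Proof.
case/two_cogroupP: (cK) => _ KN KD3 _ Ka; split=> [[b [c [Kb Kc ->]]]|Kax].
  by rewrite addrA; exact: KD3.
by exists (- a), (a + x); split=> //; [exact: KN|zmod].
Qed.

Lemma cobase_subgroup : subgroup (cobase K).
Proof.
case/two_cogroupP: (cK) => -[a Ka] KN KD3 _; apply/subgroupP; split.
  by apply/(cobaseP _ Ka); rewrite addr0.
move=> x y /(cobaseP _ Ka) Kx /(cobaseP _ Ka) Ky; apply/(cobaseP _ Ka).
have -> : a + (x - y) = a + x - (a + y) + a by zmod.
by apply: KD3 => //; exact: KN.
Qed.

Lemma cobaseF x : cobase K x -> ~ K x.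
Proof. by case/two_cogroupP: (cK) => _ _ _ KD [a [b [Ka Kb ->]]]; exact: KD. Qed.

Lemma cogroup_coset a x : K a -> K x <-> cobase K (x - a).
Proof. by move=> Ka; rewrite (cobaseP _ Ka) subrKC. Qed.

Lemma cobaseD a b : K a -> K b -> cobase K (a + b).
Proof. by move=> Ka Kb; exists a, b. Qed.

Lemma cobaseB a b : K a -> K b -> cobase K (a - b).
Proof. by move=> Ka Kb; apply: cobaseD => //; exact: cogroupN. Qed.

Lemma cogroupDl a x : K a -> cobase K x -> K (a + x).
Proof. by move=> Ka; rewrite (cobaseP _ Ka). Qed.

Lemma cogroup0 : ~ K 0.
Proof. by apply: cobaseF; apply: subgroup0 cobase_subgroup. Qed.

Lemma cobase_dbl a : K a -> cobase K (a *+ 2).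
Proof. by move=> Ka; rewrite mulr2n; exact: cobaseD. Qed.

Lemma cogroup_odd a n : K a -> odd n -> K (a *+ n).
Proof.
move=> Ka on; rewrite -[n]odd_double_half on mulrS -mul2n mulrnA.
apply: cogroupDl => //; apply: subgroupMn; first exact: cobase_subgroup.
exact: cobase_dbl.
Qed.

Lemma cobase_even a n : K a -> ~~ odd n -> cobase K (a *+ n).
Proof.
move=> Ka on; rewrite -[n]odd_double_half (negbTE on) add0n -mul2n mulrnA.
by apply: subgroupMn; [exact: cobase_subgroup|exact: cobase_dbl].
Qed.

End Cogroup.

Lemma maximal_two_cogroup_ext K :
  two_cogroup K -> exists2 M, maximal_two_cogroups M & K `<=` M.
Proof.
(* [Zorn_bigcup] also tests the empty chain, whose union is empty: hence the alternative [L = set0],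
   excluded at the end since [K] is nonempty. *)
move=> cK; pose P L := L = set0 \/ two_cogroup L /\ K `<=` L.
have [F FP Fchain|M [PM Mmax]] := @Zorn_bigcup X P.
  have [[L0 FL0 L0n]|Fn] := pselect (exists2 L, F L & L !=set0); last first.
    left; rewrite -subset0 => x [L FL Lx]; apply: Fn; exists L => //.
    by exists x.
  have FP' L : F L -> L !=set0 -> two_cogroup L /\ K `<=` L.
    by move=> FL Ln; case: (FP L FL) => // L00; move: Ln; rewrite L00 => -[].
  have two L L' : F L -> F L' -> exists2 M, F M & L `<=` M /\ L' `<=` M.
    by move=> FL FL'; case: (Fchain L L' FL FL') => LL'; [exists L'|exists L]; do ?split.
  have [_ KL0] := FP' _ FL0 L0n.
  right; split; last by move=> x /KL0 L0x; exists L0.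
  apply/two_cogroupP; split.
  - by case: L0n => x L0x; exists x, L0.
  - move=> a [L FL La]; exists L => //.
    by have [cL _] := FP' _ FL (ex_intro _ _ La); exact: cogroupN.
  - move=> a b c [La FLa aLa] [Lb FLb bLb] [Lc FLc cLc].
    have [L1 FL1 [aL1 bL1]] := two _ _ FLa FLb.
    have [L FL [L1L cL]] := two _ _ FL1 FLc.
    have La' := L1L _ (aL1 _ aLa); exists L => //.
    have [/two_cogroupP[_ _ KD3 _] _] := FP' _ FL (ex_intro _ _ La').
    by apply: KD3 => //; [exact/L1L/bL1|exact: cL].
  - move=> a b [La FLa aLa] [Lb FLb bLb] [Lc FLc cLc].
    have [L1 FL1 [aL1 bL1]] := two _ _ FLa FLb.
    have [L FL [L1L cL]] := two _ _ FL1 FLc.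
    have La' := L1L _ (aL1 _ aLa).
    have [/two_cogroupP[_ _ _ KD] _] := FP' _ FL (ex_intro _ _ La').
    by apply: (KD a b) => //; [exact/L1L/bL1|exact: cL].
have [M0|[cM KM]] := PM.
  have [a Ka] := cogroup_ex cK; exfalso; apply: (Mmax K); last by right; split.
  by rewrite M0; split=> // /(_ a Ka).
exists M => //; split=> // L cL ML; apply: contrapT => LM.
apply: (Mmax L); last by right; split=> //; exact: subset_trans ML.
by split=> // LsubM; apply: LM; rewrite eqEsubset.
Qed.

Definition finite_mod W U : Prop :=
  exists s : seq X, forall x, U x -> exists2 y, y \in s & W (x - y).

(** Doubling sends the [2 ^ k.+1]-torsion of [X / W] into the [2 ^ k]-torsion with kernel the
    2-torsion, so finiteness of the kernel propagates. *)
Lemma finite_mod_halves W : subgroup W ->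
  finite_mod W [set x | W (x *+ 2)] ->
  forall k, finite_mod W [set x | W (x *+ (2 ^ k)%N)].
Proof.
move=> sW [s1 hs1]; elim=> [|k [s hs]].
  by exists [:: 0] => x; rewrite /= expn0 mulr1n => Wx; exists 0; rewrite ?mem_head ?subr0.
pose h y := xget 0 [set z | W (z *+ 2 - y)].
exists [seq h y + z | y <- s, z <- s1] => x /=.
rewrite expnS mulrnA => /hs [y ys /= Wxy].
have Wh : W (h y *+ 2 - y) by apply: (xgetPex 0 (P := [set z | W (z *+ 2 - y)])); exists x.
have /hs1[z zs Wz] : W ((x - h y) *+ 2).
  have -> : (x - h y) *+ 2 = x *+ 2 - y - (h y *+ 2 - y) by zmod.
  exact: subgroupB.
exists (h y + z); first by apply/allpairsP; exists (y, z).
by rewrite opprD addrA.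
Qed.

(** * The quotient by the base of a maximal 2-cogroup *)

Section MaximalCogroup.
Variable K : set X.
Hypothesis mK : maximal_two_cogroups K.

Let cK : two_cogroup K. Proof. by case: mK. Qed.
Let N := cobase K.
Let sN : subgroup N. Proof. exact: cobase_subgroup. Qed.

(** Otherwise adding the multiples of [x] to [K] gives a properly larger 2-cogroup. So every
    nontrivial subgroup of [X / N] contains the class [K]. *)
Lemma maximal_cogroup_mul x : ~ N x -> exists m : int, K (x *~ m).
Proof.
move=> Nx; apply: contrapT => nK.
pose L := [set y | exists a (m : int), K a /\ y = a + x *~ m].
have [_ KN KD3 KD] := (two_cogroupP K).1 cK.
have KL : K `<=` L by move=> a Ka; exists a, 0; rewrite mulr0z addr0.
have cL : two_cogroup L.
  apply/two_cogroupP; split.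
  - by have [a Ka] := cogroup_ex cK; exists a; exact: KL.
  - move=> _ [a [m [Ka ->]]]; exists (- a), (- m); split; first exact: KN.
    by rewrite mulrNz opprD.
  - move=> _ _ _ [a [m [Ka ->]]] [b [n [Kb ->]]] [c [p [Kc ->]]].
    exists (a + b + c), (m + n + p); split; first exact: KD3.
    by rewrite !mulrzDr; zmod.
  - move=> _ _ [a [m [Ka ->]]] [b [n [Kb ->]]] [c [p [Kc E]]].
    apply: nK; exists (m + n - p); rewrite !mulrzDr mulrNz.
    have -> : x *~ m + x *~ n - x *~ p = (- a) + (- b) + (a + x *~ m + (b + x *~ n)) - x *~ p by zmod.
    rewrite E; have -> : - a - b + (c + x *~ p) - x *~ p = - a - b + c by zmod.
    by apply: KD3 => //; exact: KN.
have [_ /(_ L cL KL) LK] := mK.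
have [a Ka] := cogroup_ex cK.
by apply/Nx/(cobaseP cK _ Ka); rewrite -LK; exists a, 1; rewrite mulr1z.
Qed.

(** [K] is the only class of order two: a multiple of [x] lying in [K] must be odd, hence congruent
    to [x] modulo [N]. *)
Lemma maximal_cogroup_halves x : N (x *+ 2) -> N x \/ K x.
Proof.
move=> N2x; have [|Nx] := pselect (N x); [by left|right].
have [m Km] := maximal_cogroup_mul Nx.
have K1 : K (x *+ `|m|%N).
  by case: m Km => n //=; rewrite NegzE mulrNz => /(cogroupN cK); rewrite opprK.
have [on|en] := boolP (odd `|m|%N); last first.
  exfalso; apply: cobaseF K1 => //; rewrite -[X in _ *+ X]odd_double_half (negbTE en).
  by rewrite add0n -mul2n mulrnA; exact: subgroupMn.
apply/(cogroup_coset cK _ K1).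
rewrite -[X in x *+ X]odd_double_half on mulrS opprD addNKr -mul2n mulrnA.
by apply: subgroupN => //; exact: subgroupMn.
Qed.

Lemma maximal_cogroup_odd q x : odd q -> N (x *+ q) -> N x.
Proof.
move=> oq Nqx; apply: contrapT => Nx.
have [m Km] := maximal_cogroup_mul Nx.
apply: (@cobaseF K cK (x *~ m *+ q)); last exact: cogroup_odd.
by rewrite pmulrn -mulrzA mulrC mulrzA -pmulrn; exact: subgroupMz.
Qed.

Lemma maximal_cogroup_2power x : exists k, N (x *+ (2 ^ k)%N).
Proof.
have [Nx|Nx] := pselect (N x); first by exists 0%N.
have [m Km] := maximal_cogroup_mul Nx.
have m0 : (0 < `|m|)%N.
  rewrite absz_gt0; apply/eqP => m0; move: Km; rewrite m0 mulr0z.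
  exact: (cogroup0 cK).
have [|q] := @pfactor_coprime 2 `|m|%N _ m0; first by [].
(* The odd factor [q] of [m] is cancelled by [maximal_cogroup_odd]; the exponent is [a.+1] because
   it is the double of [x *~ m] that lies in [N]. *)
rewrite coprime2n => oq; set a := logn _ _ => mE; exists a.+1.
apply: (maximal_cogroup_odd oq).
rewrite -mulrnA expnS -mulnA [X in (2 * X)%N]mulnC -mE mulnC mulrnA.
case: m {mE m0 a} Km => n /=; first exact: cobase_dbl.
rewrite NegzE mulrNz => /(cogroupN cK); rewrite opprK; exact: cobase_dbl.
Qed.

Lemma maximal_cogroup_finite_mod k : finite_mod N [set x | N (x *+ (2 ^ k)%N)].
Proof.
apply: finite_mod_halves => //.
have [a Ka] := cogroup_ex cK.
exists [:: 0; a] => x /= /maximal_cogroup_halves[Nx|Kx].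
  by exists 0; rewrite ?subr0 // !inE eqxx.
by exists a; [rewrite !inE eqxx orbT|exact: cobaseB].
Qed.

(** In [X / N] an element of order [2 ^ j.+1] generates all the [2 ^ j.+1]-torsion: solve the
    doubled equation, then correct by the unique element of order two. *)
Lemma maximal_cogroup_cyclic j x y :
  K (x *+ (2 ^ j)%N) -> N (y *+ (2 ^ j.+1)%N) -> exists m : nat, N (y - x *+ m).
Proof.
elim: j x y => [|j IH] x y.
  rewrite expn0 mulr1n => Kx /maximal_cogroup_halves[Ny|Ky].
    by exists 0%N; rewrite mulr0n subr0.
  by exists 1%N; exact: cobaseB.
move=> Kx Ny; have [||m Nm] := IH (x *+ 2) (y *+ 2).
- by rewrite -mulrnA -expnS.
- by rewrite -mulrnA -expnS.
have /maximal_cogroup_halves[N'|K'] : N ((y - x *+ m) *+ 2).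
- by rewrite mulrnBl -!mulrnA mulnC mulrnA.
- by exists m.
exists (m + 2 ^ j.+1)%N.
by rewrite mulrnDr opprD addrA; exact: cobaseB.
Qed.

End MaximalCogroup.
End Subgroups.

(** * Maximal linked systems as equivariant functions *)

Section Superextension.
Variable X : zmodType.
Implicit Types (A B C D K : set X) (L M : PPX X) (x y z k : X).

Definition shiftset x A : set X := [set y | A (x + y)].

Lemma shiftset0 A : shiftset 0 A = A.
Proof. by apply/funext => y; rewrite /shiftset /= add0r. Qed.

Lemma shiftsetD x y A : shiftset x (shiftset y A) = shiftset (x + y) A.
Proof. by apply/funext => z; rewrite /shiftset /= addrA [y + x]addrC. Qed.

Lemma shiftset_inj x : injective (shiftset x).
Proof. by move=> A B AB; rewrite -[A]shiftset0 -[B]shiftset0 -(addNr x) -!shiftsetD AB. Qed.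

Lemma shiftset_subset x A B : A `<=` B -> shiftset x A `<=` shiftset x B.
Proof. by move=> AB y; exact: AB. Qed.

(** [A] is a twin set when [negset A] is nonempty. *)
Definition negset A : set X := [set k | shiftset k A = ~` A].

Lemma setC_neq A : ~` A <> A.
Proof.
move=> /(congr1 (@^~ 0)) /= E.
by have [a|na] := pselect (A 0); [move: (a); rewrite -E|apply: (na); rewrite -E].
Qed.

Lemma negset_cogroup A : negset A !=set0 -> two_cogroup (negset A).
Proof.
move=> n0; apply/two_cogroupP; split=> //.
- move=> a /= na; rewrite /negset /=; apply: (@shiftset_inj a).
  by rewrite shiftsetD subrr shiftset0 -[RHS]/(~` shiftset a A) na setCK.
- move=> a b c /= na nb nc; rewrite /negset /= -!shiftsetD nc.
  by rewrite -[shiftset b _]/(~` shiftset b A) nb setCK na.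
- move=> a b /= na nb; rewrite /negset /= -shiftsetD nb.
  by rewrite -[shiftset a _]/(~` shiftset a A) na setCK => /esym; exact: setC_neq.
Qed.

Lemma negset_shift x A : negset (shiftset x A) = negset A.
Proof.
apply/funext => k; rewrite /negset /= shiftsetD addrC -shiftsetD.
by apply/propext; split=> [|->//]; rewrite -[~` shiftset x A]/(shiftset x (~` A)) => /shiftset_inj.
Qed.

Lemma negset_setC A : negset (~` A) = negset A.
Proof.
apply/funext => k; apply/propext; rewrite /negset /= -[shiftset k (~` A)]/(~` shiftset k A).
by split=> [/setC_inj //|->].
Qed.

(** A shift fixing a twin set [C] is a difference of elements of [negset C],
    hence also fixes every [D] with [negset C `<=` negset D]. *)
Lemma negset_shift_eq C D x y : negset C !=set0 -> negset C `<=` negset D ->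
  shiftset x C = shiftset y C -> shiftset x D = shiftset y D.
Proof.
move=> [k kC] CD xy; apply: (@shiftset_inj (k - y)).
rewrite !shiftsetD subrK [RHS]CD // (CD (k - y + x)) // /negset /=.
by rewrite -shiftsetD xy shiftsetD subrK.
Qed.

(** If neither [z] nor [x + z] were in [A], the second inclusion would put [y + z] and [x + y + z]
    in [A], against the first; commutativity enters here. *)
Lemma pretwin A x y : shiftset x A `<=` ~` A -> ~` A `<=` shiftset y A -> negset A x.
Proof.
move=> P Q; rewrite /negset /= eqEsubset; split=> // z nAz.
apply: contrapT => nAxz; have Ayz := Q _ nAz.
by apply: (P (y + z)) => //; rewrite /shiftset /= addrCA; exact: Q.
Qed.

(** Twin sets form an antichain, so monotonicity relates no two distinct ones and their images may
    be chosen orbit by orbit. *)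
Lemma twin_subset_eq A B :
  negset A !=set0 -> negset B !=set0 -> A `<=` B -> A = B.
Proof.
move=> [k kA] [l lB] AB; rewrite eqEsubset; split=> //.
have /subsetC nBA := AB.
have lA : shiftset l A `<=` ~` B by rewrite -lB; exact: shiftset_subset.
have : negset A l.
  by apply: (@pretwin A l k); [exact: subset_trans nBA|rewrite kA].
rewrite /negset /= => E; move: lA; rewrite E => /subsetC.
by rewrite !setCK.
Qed.

(** Maximality is applied by adjoining a single set to [L] and checking that the family stays
    linked. *)
Lemma maximal_linkedP L :
  maximal_linked L <->
  (forall A B, A `<=` B -> L A -> L B) /\ (forall A, L (~` A) <-> ~ L A).
Proof.
split=> [[lL mL]|[up sd]]; last first.
  have lL : linked L.
    move=> A B LA LB; apply: contrapT => AB.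
    apply: (sd A).1 => //; apply: up LB => x Bx Ax.
    by apply: AB; exists x.
  split=> // M lM LM; rewrite eqEsubset; split=> // A MA.
  apply: contrapT => /sd /LM MnA.
  by have [x []] := lM _ _ MA MnA.
have up A B : A `<=` B -> L A -> L B.
  move=> AB LA; pose M : PPX X := [set C | L C \/ C = B].
  have LM : L `<=` M by left.
  suff <- : M = L by right.
  apply: mL => // C D [LC|->] [LD|->]; first exact: lL.
  - by have [x [Cx Ax]] := lL _ _ LC LA; exists x; split=> //; exact: AB.
  - by have [x [Cx Ax]] := lL _ _ LA LD; exists x; split=> //; exact: AB.
  - by have [x [Ax _]] := lL _ _ LA LA; exists x; split; exact: AB.
have LT : L setT.
  pose M : PPX X := [set C | L C \/ C = setT].
  have LM : L `<=` M by left.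
  suff <- : M = L by right.
  apply: mL => // C D [LC|->] [LD|->]; first exact: lL.
  - by have [x [Cx _]] := lL _ _ LC LC; exists x.
  - by have [x [Cx _]] := lL _ _ LD LD; exists x.
  - by exists 0.
split=> // A; split=> [LnA LA|nLA]; first by have [x []] := lL _ _ LA LnA.
pose M : PPX X := [set C | L C \/ C = ~` A].
have LM : L `<=` M by left.
have LAn C : L C -> C `&` ~` A !=set0.
  move=> LC; apply: contrapT => nCA; apply: nLA; apply: up LC => x Cx.
  by apply: contrapT => nAx; apply: nCA; exists x.
suff <- : M = L by right.
apply: mL => // C D [LC|->] [LD|->]; first exact: lL.
- exact: LAn.
- by rewrite setIC; exact: LAn.
- by have [x []] := LAn _ LT; exists x.
Qed.

Definition phi L A : set X := [set x | L (shiftset x A)].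

Lemma circE L M A : circ L M A = L (phi M A).
Proof. by []. Qed.

Lemma phi_shift L x A : phi L (shiftset x A) = shiftset x (phi L A).
Proof.
apply/funext => y; rewrite -[LHS]/(L (shiftset y (shiftset x A))).
by rewrite shiftsetD addrC.
Qed.

Lemma phi_circ L M A : phi (circ L M) A = phi L (phi M A).
Proof. by apply/funext => x; rewrite /phi /= circE phi_shift. Qed.

Lemma circA L M P : circ (circ L M) P = circ L (circ M P).
Proof. by apply/funext => A; rewrite !circE phi_circ. Qed.

Lemma phi_inj L M : phi L =1 phi M -> L = M.
Proof.
move=> E; apply/funext => A; have := congr1 (@^~ 0) (E A).
by rewrite /phi /= !shiftset0.
Qed.

Section MaximalLinked.
Variable L : PPX X.
Hypothesis mL : maximal_linked L.

Lemma phi_subset A B : A `<=` B -> phi L A `<=` phi L B.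
Proof.
case/maximal_linkedP: mL => up _ AB x; rewrite /phi /=; apply: up.
exact: shiftset_subset.
Qed.

Lemma phi_setC A : phi L (~` A) = ~` phi L A.
Proof. by case/maximal_linkedP: mL => _ sd; apply/funext => x; apply/propext/sd. Qed.

Lemma phi_setT : phi L setT = setT.
Proof.
case/maximal_linkedP: mL => up sd; apply/funext => x; apply/propext; split=> // _.
rewrite /phi /=; apply: contrapT => nL; have := (sd (shiftset x setT)).2 nL.
by move=> LC; apply: nL; apply: up LC.
Qed.

Lemma phi_set0 : phi L set0 = set0.
Proof. by rewrite -setCT phi_setC phi_setT. Qed.

Lemma negset_phi A : negset A `<=` negset (phi L A).
Proof. by move=> k kA; rewrite /negset /= -phi_shift kA phi_setC. Qed.

End MaximalLinked.

Lemma circ_maximal_linked L M :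
  maximal_linked L -> maximal_linked M -> maximal_linked (circ L M).
Proof.
move=> mL mM; have [upL sdL] := (maximal_linkedP L).1 mL.
apply/maximal_linkedP; split=> [A B AB|A]; rewrite !circE.
  by apply: upL; exact: phi_subset.
by rewrite phi_setC.
Qed.

(** Equivariance recovers [F A] from the values at 0 on the shifts of [A], so [L] is read off at
    0. *)
Lemma equivariant_phi (F : set X -> set X) :
  (forall x A, F (shiftset x A) = shiftset x (F A)) ->
  (forall A B, A `<=` B -> F A `<=` F B) ->
  (forall A, F (~` A) = ~` F A) ->
  exists2 L, maximal_linked L & phi L = F.
Proof.
move=> Fshift Fsub FC; exists [set A | F A 0].
  by apply/maximal_linkedP; split=> [A B /Fsub|A] /=; [exact|rewrite FC].
apply/funext => A; apply/funext => x.
by rewrite /phi /= Fshift /shiftset /= addr0.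
Qed.

(** Take a maximal shift-invariant linked family. If neither [A] nor its complement belongs to it,
    their orbits cannot be adjoined, so each is disjoint from one of its shifts, and [pretwin]
    applies. *)
Lemma maximal_invariant_linked : exists L,
  [/\ linked L, forall x A, L A -> L (shiftset x A),
      forall A B, A `<=` B -> L A -> L B
    & forall A, [\/ L A, L (~` A) | negset A !=set0]].
Proof.
pose P (M : PPX X) := linked M /\ forall x A, M A -> M (shiftset x A).
have [F FP Fchain|L [[lL sL] Lmax]] := @Zorn_bigcup (set X) P.
  split=> [A B [M FM MA] [N FN NB]|x A [M FM MA]]; last first.
    by exists M => //; apply: (FP _ FM).2.
  by case: (Fchain M N FM FN) => MN; [apply: (FP _ FN).1|apply: (FP _ FM).1] => //; exact: MN.
have add A : (forall x, A `&` shiftset x A !=set0) ->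
    (forall B, L B -> A `&` B !=set0) -> L A.
  move=> AA AB; apply: contrapT => nLA.
  pose M : PPX X := [set C | L C \/ exists x, C = shiftset x A].
  apply: (Lmax M).
    split=> [C LC|ML]; first by left.
    by apply/nLA/ML; right; exists 0; rewrite shiftset0.
  have cross x B : L B -> shiftset x A `&` B !=set0.
    move=> /(sL (- x))/AB[z [Az Bz]]; exists (- x + z); split=> //.
    by rewrite /shiftset /= addNKr.
  split=> [C D [LC|[x ->]] [LD|[y ->]]|x C [LC|[y ->]]].
  - exact: lL.
  - by rewrite setIC; exact: cross.
  - exact: cross.
  - have [z [Az Ayz]] := AA (y - x); exists (z - x); rewrite /shiftset /=.
    have -> : x + (z - x) = z by zmod.
    by have -> : y + (z - x) = y - x + z by zmod.
  - by left; exact: sL.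
  - by right; exists (x + y); rewrite shiftsetD.
have up A B : A `<=` B -> L A -> L B.
  move=> AB LA; apply: add => [x|C LC].
    have [z [Az Axz]] := lL _ _ LA (sL x _ LA).
    by exists z; split; [exact: AB|exact: AB Axz].
  by have [z [Az Cz]] := lL _ _ LA LC; exists z; split=> //; exact: AB.
exists L; split=> // A.
have [LA|nLA] := pselect (L A); first by constructor 1.
have [LnA|nLnA] := pselect (L (~` A)); first by constructor 2.
have key B : ~ L B -> ~ L (~` B) -> exists x, shiftset x B `<=` ~` B.
  move=> nLB nLnB; apply: contrapT => nx; apply: nLB; apply: add => [x|C LC].
    apply: contrapT => Bx; apply: nx; exists x => z Bxz Bz.
    by apply: Bx; exists z.
  apply: contrapT => BC; apply: nLnB; apply: up LC => z Cz Bz.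
  by apply: BC; exists z.
have [x xA] := key A nLA nLnA.
have [|y yA] := key (~` A) nLnA; first by rewrite setCK.
constructor 3; exists x; apply: (@pretwin A x y) => //.
by apply: subsetC2; rewrite setCK; move: yA; rewrite setCK.
Qed.

Definition shift_orbit A : set (set X) := [set B | exists x, B = shiftset x A].

Lemma shift_orbit_shift x A : shift_orbit (shiftset x A) = shift_orbit A.
Proof.
apply/funext => B; apply/propext; split=> -[y ->].
  by exists (y + x); rewrite shiftsetD.
by exists (y - x); rewrite shiftsetD subrK.
Qed.

Lemma shift_orbit_refl A : shift_orbit A A. Proof. by exists 0; rewrite shiftset0. Qed.

Lemma negset_maximal K A :
  maximal_two_cogroups K -> K `<=` negset A -> negset A = K.
Proof.
move=> [[[k Kk] _] Kmax] KA; apply: Kmax => //; apply: negset_cogroup.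
by exists k; exact: KA.
Qed.

(** Non-twin sets are sent to [set0] or [setT] along a maximal invariant linked
    family; the shift_orbit of a twin set [C] is sent equivariantly to the shift_orbit of
    [A K] for some maximal [K] containing [negset C]. *)
Lemma twin_extension (A B : set X -> set X) :
  (forall K, maximal_two_cogroups K -> K `<=` negset (A K)) ->
  (forall K, maximal_two_cogroups K -> K `<=` negset (B K)) ->
  exists L, [/\ maximal_linked L,
    forall K, maximal_two_cogroups K -> phi L (B K) = A K
  & forall C, [\/ phi L C = set0, phi L C = setT
    | exists K x, maximal_two_cogroups K /\ phi L C = shiftset x (A K)]].
Proof.
move=> hA hB; have [LL [lLL sLL uLL triLL]] := maximal_invariant_linked.
(* A good pair for an orbit is a maximal 2-cogroup [K] and a base point, to be sent to [A K]; an
   orbit meeting the family [B] is forced to use [(K, B K)]. *)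
pose good (O : set (set X)) := [set p : set X * set X |
  [/\ maximal_two_cogroups p.1, O p.2, negset p.2 `<=` p.1
    & forall K, maximal_two_cogroups K -> O (B K) -> p = (K, B K)]].
pose pick C := xget (set0, set0) (good (shift_orbit C)).
have pickP C : negset C !=set0 -> good (shift_orbit C) (pick C).
  move=> nC; apply: (xgetPex (set0, set0)).
  have [[K [mK [x BK]]]|nK] :=
      pselect (exists K, maximal_two_cogroups K /\ shift_orbit C (B K)).
    exists (K, B K); split=> //=; first by exists x.
      by rewrite (negset_maximal mK (hB _ mK)).
    move=> K' mK' [y BK'].
    (* [B K] and [B K'] lie in one orbit, so they have the same [negset], which by maximality is
       both [K] and [K']. *)
    suff -> : K' = K by [].
    rewrite -(negset_maximal mK (hB _ mK)) -(negset_maximal mK' (hB _ mK')).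
    by rewrite BK BK' !negset_shift.
  have [K mK CK] := maximal_two_cogroup_ext (negset_cogroup nC).
  exists (K, C); split=> //=; first exact: shift_orbit_refl.
  by move=> K' mK' OK'; exfalso; apply: nK; exists K'.
have pick_shift x C : pick (shiftset x C) = pick C by rewrite /pick shift_orbit_shift.
pose G C := [set x | exists z, C = shiftset z (pick C).2 /\ shiftset z (A (pick C).1) x].
have GE C z : negset C !=set0 -> C = shiftset z (pick C).2 -> G C = shiftset z (A (pick C).1).
  move=> nC CE; have [mK _ nK _] := pickP C nC.
  apply/funext => x; apply/propext; split=> [[z' [CE' Ax]]|Ax]; last by exists z.
  (* Well-definedness: shifts that agree on the base point agree on its image, whose [negset] is at
     least as large. *)
  suff -> : shiftset z (A (pick C).1) = shiftset z' (A (pick C).1) by [].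
  apply: (@negset_shift_eq (pick C).2); last by rewrite -CE -CE'.
  - by move: nC; rewrite {1}CE negset_shift.
  - by apply: (subset_trans nK); exact: hA.
have pick_ex C : negset C !=set0 -> exists z, C = shiftset z (pick C).2.
  move=> nC; have [_ [z ->] _ _] := pickP C nC.
  by exists (- z); rewrite shiftsetD addNr shiftset0.
have G_shift x C : negset C !=set0 -> G (shiftset x C) = shiftset x (G C).
  move=> nC; have [z CE] := pick_ex C nC.
  rewrite (GE C z) // (GE _ (x + z)) ?negset_shift ?pick_shift ?shiftsetD //.
  by rewrite -shiftsetD -CE.
have GC C : negset C !=set0 -> G (~` C) = ~` G C.
  move=> nC; have [k kC] := nC; rewrite -kC G_shift //.
  have [z CE] := pick_ex C nC; rewrite (GE C z) //.
  have [mK _ nK _] := pickP C nC.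
  have : negset (shiftset z (A (pick C).1)) k.
    by rewrite negset_shift; apply: hA => //; apply: nK; move: kC; rewrite {1}CE negset_shift.
  by [].
have twinF C : negset C !=set0 -> ~ LL C.
  move=> [k kC] LC; have [z []] := lLL _ _ LC (sLL k _ LC).
  by rewrite kC.
have LLC C : LL C -> ~ LL (~` C).
  by move=> LC LnC; have [z []] := lLL _ _ LC LnC.
pose F C := if `[< LL C >] then setT else if `[< LL (~` C) >] then set0 else G C.
have FT C : LL C -> F C = setT by move=> LC; rewrite /F asboolT.
have F0 C : LL (~` C) -> F C = set0.
  move=> LC; rewrite /F asboolF ?asboolT //; have := LLC _ LC.
  by rewrite setCK.
have FG C : negset C !=set0 -> F C = G C.
  by move=> nC; rewrite /F !asboolF //; apply: twinF; rewrite ?negset_setC.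
have [L mL LF] : exists2 L, maximal_linked L & phi L = F.
  apply: equivariant_phi => [x C|C D CD|C].
  - have [LC|LC|nC] := triLL C.
    + by rewrite !FT //; exact: sLL.
    + by rewrite !F0 //; exact: (sLL x _ LC).
    + by rewrite !FG ?negset_shift // G_shift.
  - have [LC|LC|nC] := triLL C; first by rewrite !FT //; exact: uLL LC.
      by rewrite (F0 C).
    have [LD|LD|nD] := triLL D; first by rewrite (FT D).
      by case: (@twinF (~` C)); [rewrite negset_setC|exact: uLL (subsetC CD) LD].
    by rewrite (twin_subset_eq nC nD CD).
  - have [LC|LC|nC] := triLL C.
    + by rewrite (FT C) // F0 ?setCT // setCK.
    + by rewrite (F0 C) // FT // setC0.
    + by rewrite !FG ?negset_setC // GC.
have BK K : maximal_two_cogroups K -> negset (B K) !=set0.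
  by move=> mK; have [[[k Kk] _] _] := mK; exists k; exact: hB.
exists L; split=> // [K mK|C]; rewrite LF.
  have [_ _ _ /(_ K mK (shift_orbit_refl _)) pE] := pickP _ (BK K mK).
  have nB := BK _ mK; rewrite (FG _ nB) (GE _ 0 nB) pE /= shiftset0 //.
have [LC|LC|nC] := triLL C; first by constructor 2; exact: FT.
  by constructor 1; exact: F0.
have [z CE] := pick_ex C nC; have [mK _ _ _] := pickP C nC.
by constructor 3; exists (pick C).1, z; rewrite FG // (GE C z).
Qed.

(** Each coset of the subgroup formed by [N] and [K] together splits into two cosets of [N]. The set
    [A] takes the half containing the representative [c x], and shifts by [K] exchange the
    halves. *)
Lemma cogroup_negset K : two_cogroup K -> exists A, K `<=` negset A.
Proof.
move=> cK; have sN := cobase_subgroup cK; pose N := cobase K.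
have NK k u : K k -> N u \/ K u -> N (k + u) <-> ~ N u.
  move=> Kk [Nu|Ku]; split=> //.
  - by move=> Nku; have /(cobaseF cK) [] := Nku; exact: cogroupDl.
  - by move=> _ /(cobaseF cK).
  - by move=> _; exact: cobaseD.
have HK k u : K k -> N u \/ K u -> N (k + u) \/ K (k + u).
  by move=> Kk [Nu|Ku]; [right; exact: cogroupDl|left; exact: cobaseD].
pose c x := xget 0 [set y | N (x - y) \/ K (x - y)].
have cP x : N (x - c x) \/ K (x - c x).
  by apply: (xgetPex 0 (P := [set y | N (x - y) \/ K (x - y)])); exists x; left;
     rewrite subrr; exact: subgroup0.
have cK' k x : K k -> c (k + x) = c x.
  move=> Kk; rewrite /c; congr (xget _ _); apply/funext => y; apply/propext.
  split=> /= [H|H]; last by rewrite -addrA; exact: HK.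
  have -> : x - y = - k + (k + x - y) by zmod.
  by apply: HK => //; exact: cogroupN.
exists [set x | N (x - c x)] => k Kk.
apply/funext => x; apply/propext; rewrite /shiftset /= cK' // -addrA.
exact: NK.
Qed.

End Superextension.

(** * Minimal left ideals and metrizability *)

Lemma cvg_initial (S : choiceType) (T : topologicalType) (f : S -> T)
    (F : set_system S) (x : S) : Filter F ->
  (f @ F --> f x) -> F --> (x : initial_topology f).
Proof.
move=> FF fF V; rewrite nbhsE => -[B [[C oC <-] Cx] BV].
apply: (filterS BV); apply: fF; exact: open_nbhs_nbhs.
Qed.

Lemma nbhs_set_typeP (X : Type) (I : set (PPX X)) (L : set_type I)
    (U : set (set_type I)) :
  nbhs L U <-> exists s : seq (set X), forall M : set_type I,
    (forall A, A \in s -> val M A <-> val L A) -> U M.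
Proof.
pose F : set_system (set_type I) := [set U | exists s : seq (set X),
  forall M : set_type I, (forall A, A \in s -> val M A <-> val L A) -> U M].
have FF : Filter F.
  split; first by exists [::].
    move=> P Q [s sP] [t tQ]; exists (s ++ t) => M hM; split.
      by apply: sP => A As; apply: hM; rewrite mem_cat As.
    by apply: tQ => A As; apply: hM; rewrite mem_cat As orbT.
  by move=> P Q PQ [s sP]; exists s => M /sP/PQ.
rewrite -/(F U); split.
  move: U; change (F --> L); apply: cvg_initial.
  apply: (@cvg_initial _ _ (@char_fun X)).
  apply/cvg_sup => A; apply: cvg_initial => V /nbhs_singleton VL.
  exists [:: A] => M /(_ A (mem_head _ _)) MA.
  by rewrite /= /char_fun; rewrite (_ : `[< _ >] = char_fun (val L) A) //; apply/asbool_equiv_eq.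
case=> s; elim: s U => [|A s IH] U hU.
  by apply: filterS filterT => M _; apply: hU.
have : nbhs L [set M : set_type I | val M A <-> val L A].
  have cA : continuous (fun M : set_type I => char_fun (val M) A).
    move=> M; apply: (@continuous_comp _ _ _ (fun M : set_type I => char_fun (val M)) (fun f => f A)).
      apply: continuous_comp; first exact: (@initial_continuous (set_type I) (PPX X) (fun M => val M)).
      exact: (@initial_continuous _ _ (@char_fun X)).
    have := @proj_continuous (set X) (fun=> bool) A.
    by move=> /(_ (char_fun (val M))).
  have nA : nbhs L [set M | char_fun (val M) A = char_fun (val L) A].
    exact: cA L _ (discrete_set1 (char_fun (val L) A)).
  apply: (filterS _ nA) => M; exact: asbool_eq_equiv.
move=> nA; have nB : nbhs L [set M : set_type I | forall B, B \in s -> val M B <-> val L B].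
  exact: IH.
apply: filterS (filterI nA nB) => M [/= MA MB]; apply: hU => B.
by rewrite inE => /predU1P[->|]; [|exact: MB].
Qed.

(** The distance is [1 / (n + 1)] for the first [n] such that the two families disagree on [e n]; on
    [I] every coordinate agrees with one of these. *)
Lemma metrizable_countable_base (R : realType) (X : Type) (I : set (PPX X))
    (e : nat -> set X) :
  (forall A, exists n, forall L, I L -> L A <-> L (e n)) ->
  metrizable R (set_type I).
Proof.
move=> eP.
pose differ (L M : set_type I) n := `[< ~ (val L (e n) <-> val M (e n)) >].
have agree L M n : ~~ differ L M n -> val L (e n) <-> val M (e n).
  by move=> /asboolPn/contrapT.
pose d (L M : set_type I) : R :=
  if pselect (exists n, differ L M n) is left h then (ex_minn h).+1%:R^-1 else 0.
have d_ge L M n : differ L M n -> n.+1%:R^-1 <= d L M.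
  rewrite /d; case: pselect => [h|nh] Dn; last by exfalso; apply: nh; exists n.
  by case: ex_minnP => m _ /(_ n Dn) mn; rewrite lef_pV2 ?posrE // ler_nat ltnS.
have d_cases L M : d L M = 0 \/ exists2 n, differ L M n & d L M = n.+1%:R^-1.
  rewrite /d; case: pselect => [h|nh]; last by left.
  by right; case: ex_minnP => m Dm _; exists m.
have differC L M n : differ L M n -> differ M L n.
  by rewrite /differ => /asboolP D; apply/asboolP => -[h1 h2]; apply: D; split.
have d0 L M : 0 <= d L M.
  by case: (d_cases L M) => [->//|[n _ ->]]; rewrite invr_ge0.
have dC L M : d L M <= d M L.
  by case: (d_cases L M) => [->//|[n D ->]]; apply: d_ge; exact: differC.
exists d; split=> //.
- move=> L M; split=> [dLM|->]; last first.
    case: (d_cases M M) => // -[n /asboolP D _]; exfalso; exact: D.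
  apply/val_inj/funext => A; have [n hn] := eP A; apply/propext.
  rewrite (hn _ (set_valP L)) (hn _ (set_valP M)); apply: agree.
  by apply/negP => /d_ge; rewrite dLM leNgt invr_gt0 ltr0Sn.
- by move=> L M; apply/eqP; rewrite eq_le !dC.
- move=> L M N; case: (d_cases L N) => [->|[n /asboolP D ->]]; first exact: addr_ge0.
  have [D1|/agree D1] := boolP (differ L M n).
    by apply: (le_trans (d_ge _ _ _ D1)); rewrite lerDl.
  have [D2|/agree D2] := boolP (differ M N n).
    by apply: (le_trans (d_ge _ _ _ D2)); rewrite lerDr.
  by exfalso; apply: D; rewrite D1.
- apply/funext => L; apply/funext => U; apply/propext; split; last first.
    move=> /nbhs_set_typeP[s sU].
    have [N hN] : exists N, forall M, (forall n, (n <= N)%N -> ~~ differ L M n) ->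
        forall A, A \in s -> val M A <-> val L A.
      elim: s {sU} => [|A s [N hN]]; first by exists 0%N.
      have [n hn] := eP A; exists (maxn n N) => M hM B.
      rewrite inE => /predU1P[->|]; last first.
        by apply: hN => m mN; apply: hM; rewrite leq_max mN orbT.
      rewrite (hn _ (set_valP L)) (hn _ (set_valP M)); apply: iff_sym; apply: agree.
      by apply: hM; rewrite leq_maxl.
    exists N.+1%:R^-1; first by rewrite /= invr_gt0.
    move=> M /= dN; apply: sU; apply: hN => n nN; apply/negP => /d_ge.
    by rewrite leNgt (lt_le_trans dN) // lef_pV2 ?posrE // ler_nat.
  move=> [r /= r0 rU]; apply/nbhs_set_typeP.
  have [N] := ltr_add_invr r0; rewrite add0r => Nr.
  exists [seq e n | n <- iota 0 N.+1] => M hM; apply: rU => /=.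
  have [->//|[n /asboolP D ->]] := d_cases L M.
  have [nN|Nn] := leqP n N.
    exfalso; apply: D; apply: iff_sym; apply: hM.
    by apply: map_f; rewrite mem_iota.
  by apply: le_lt_trans Nr; rewrite lef_pV2 ?posrE // ler_nat ltnS ltnW.
Qed.

Section MinimalLeftIdeals.
Variable X : zmodType.
Implicit Types (A B C K : set X) (L M : PPX X).

Lemma cobase_shift K A x : K `<=` negset A -> cobase K x -> shiftset x A = A.
Proof.
move=> KA [a [b [/KA na /KA nb ->]]]; rewrite -shiftsetD nb.
by rewrite -[shiftset a _]/(~` shiftset a A) na setCK.
Qed.

(** The orbit is an image of [X / cobase K], the union of its finite [2 ^ k]-torsion subgroups. *)
Lemma shift_orbit_countable K A :
  maximal_two_cogroups K -> K `<=` negset A -> countable (shift_orbit A).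
Proof.
move=> mK KA.
have fin k := maximal_cogroup_finite_mod mK k.
pose s k := xget [::] [set s : seq X | forall x, cobase K (x *+ (2 ^ k)%N) ->
  exists2 y, y \in s & cobase K (x - y)].
have sP k x : cobase K (x *+ (2 ^ k)%N) -> exists2 y, y \in s k & cobase K (x - y).
  have [t tP] := fin k.
  exact: (xgetPex [::] (P := [set s : seq X | forall x, cobase K (x *+ (2 ^ k)%N) ->
    exists2 y, y \in s & cobase K (x - y)]) (ex_intro _ t tP)).
have sub : shift_orbit A `<=` \bigcup_k ((fun x => shiftset x A) @` [set` s k]).
  move=> _ [x ->]; have [k /sP[y ys Nxy]] := maximal_cogroup_2power mK x.
  exists k => //; exists y => //.
  by rewrite -[in LHS](cobase_shift KA Nxy) shiftsetD subrKC.
apply: sub_countable (subset_card_le sub) _; apply: bigcup_countable => // k _.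
exact: sub_countable (card_image_le _ _) (finite_set_countable (finite_seq _)).
Qed.

Definition twin_rep K := xget set0 [set A | K `<=` negset A].

Lemma twin_repP K : maximal_two_cogroups K -> K `<=` negset (twin_rep K).
Proof.
move=> [cK _]; have [A KA] := cogroup_negset cK.
exact: (xgetPex set0 (P := [set A | K `<=` negset A]) (ex_intro _ A KA)).
Qed.

Lemma circ_left_ideal M : superextension M ->
  left_ideal (@superextension X) (@circ X) [set circ L M | L in @superextension X].
Proof.
move=> mM; split=> [_ [L mL <-]||L _ mL [L' mL' <-]].
- exact: circ_maximal_linked.
- by exists (circ M M), M.
- by exists (circ L L'); [exact: circ_maximal_linked|rewrite circA].
Qed.

Lemma metrizable_minimal_left_ideal (R : realType) :
  countable (@maximal_two_cogroups X) ->
  forall I, minimal_left_ideal (@superextension X) (@circ X) I ->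
  metrizable R (set_type I).
Proof.
move=> cK I [[IS [M IM] Iop] Imin].
have [E [mE _ imE]] := twin_extension twin_repP twin_repP.
pose c := [set set0; setT] `|`
  \bigcup_(K in @maximal_two_cogroups X) shift_orbit (twin_rep K).
have cc : countable c.
  rewrite /c -bigcup2E; apply: bigcup_countable => // -[|[|n]] _ /=.
  - exact: finite_set_countable (finite_set2 _ _).
  - apply: bigcup_countable => // K mK; apply: (shift_orbit_countable mK).
    exact: twin_repP mK.
  - exact: (@countable0 (set X)).
(* [phi E] has all its values in the countable family [c], hence so has [phi M']; by minimality [M']
   generates [I]. *)
pose M' := circ E M; have IM' : I M' by exact: Iop.
have [f fi] := countable_injP _ cc.
have cM' A : c (phi M' A).
  rewrite phi_circ; case: (imE (phi M A)) => [->|->|[K [x [mK ->]]]].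
  - by left; left.
  - by left; right.
  - by right; exists K => //; exists x.
have IE : [set circ L M' | L in @superextension X] = I.
  by apply: Imin; [exact/circ_left_ideal/IS|move=> _ [L mL <-]; exact: Iop].
(* Elements [circ L M'] of [I] see [A] only through [phi M' A]; [e n] is a set whose value has code
   [n], if there is one. *)
pose e n := xget set0 [set A | f (phi M' A) = n].
apply: (metrizable_countable_base R (e := e)) => A; exists (f (phi M' A)).
have eP : f (phi M' (e (f (phi M' A)))) = f (phi M' A).
  by apply: (xgetPex set0 (P := [set B | f (phi M' B) = f (phi M' A)])); exists A.
rewrite -IE => _ [L _ <-]; rewrite !circE.
by rewrite (fi _ _ _ _ eP) // inE; exact: cM'.
Qed.

Lemma countable_maximal_cogroups (R : realType) :
  (forall I, minimal_left_ideal (@superextension X) (@circ X) I ->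
    metrizable R (set_type I)) ->
  countable (@maximal_two_cogroups X).
Proof.
move=> met.
have [E [mE E1 imE]] := twin_extension twin_repP twin_repP.
pose I := [set circ L E | L in @superextension X].
have repP K : maximal_two_cogroups K -> negset (twin_rep K) = K.
  by move=> mK; apply: negset_maximal => //; exact: twin_repP.
have same L : superextension L ->
    (forall K, maximal_two_cogroups K -> phi L (twin_rep K) = twin_rep K) ->
    circ L E = E.
  move=> mL LE; apply: phi_inj => A; rewrite phi_circ.
  case: (imE A) => [->|->|[K [x [mK ->]]]].
  - exact: phi_set0.
  - exact: phi_setT.
  - by rewrite phi_shift LE.
have mI : minimal_left_ideal (@superextension X) (@circ X) I.
  split; first exact: circ_left_ideal.
  move=> J [JS [P JP] Jop] JI; rewrite eqEsubset; split=> // _ [L mL <-].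
  have [M mM ME] := JI _ JP.
  (* [L'] undoes [M] on the representatives, so that [circ L' P] is [E]; thus [J] contains [E] and
     with it [I]. *)
  have [K|L' [mL' L'P _]] := twin_extension twin_repP (B := fun K => phi M (twin_rep K)).
    by move=> mK; apply: (subset_trans (twin_repP mK)); exact: negset_phi.
  have <- : circ L' P = E.
    rewrite -ME -circA; apply: same; first exact: circ_maximal_linked.
    by move=> K mK; rewrite phi_circ L'P.
  by apply: (Jop _ _ mL); apply: (Jop _ _ mL').
have [d [d0 dE dC dT dN]] := met I mI.
have IE : I E by exists E => //; apply: same => // K mK; exact: E1.
pose E' : set_type I := SigSub (mem_set IE).
have base n : exists s : seq (set X), forall M : set_type I,
    (forall A, A \in s -> val M A <-> val E' A) -> d E' M < n.+1%:R^-1.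
  have : nbhs E' [set M | d E' M < n.+1%:R^-1].
    by rewrite -dN; exists n.+1%:R^-1 => //=; rewrite invr_gt0.
  by move=> /nbhs_set_typeP.
pose s n := projT1 (cid (base n)); have sP n := projT2 (cid (base n)).
(* The 2-cogroups seen by the coordinates that bound the distance to [E]. *)
pose c := \bigcup_n ((fun A => negset (phi E A)) @` [set` s n]).
have cc : countable c.
  apply: bigcup_countable => // k _.
  exact: sub_countable (card_image_le _ _) (finite_set_countable (finite_seq _)).
apply: sub_countable cc; apply: subset_card_le => K0 mK0; apply: contrapT => cK0.
(* [L] complements the representative of [K0] and fixes the others. As [K0] is unseen, [circ L E] is
   at distance 0 from [E], yet they act differently on [twin_rep K0]. *)
pose B K := if `[< K = K0 >] then ~` twin_rep K else twin_rep K.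
have [K mK|L [mL LB _]] := twin_extension (A := B) _ twin_repP.
  by rewrite /B; case: ifP => _; rewrite ?negset_setC; exact: twin_repP.
have IL : I (circ L E) by exists L.
pose L' : set_type I := SigSub (mem_set IL).
have EL : E' = L'.
  apply/dE/eqP; rewrite eq_le d0 andbT leNgt; apply/negP => r0.
  have [n] := ltr_add_invr r0; rewrite add0r; apply/negP; rewrite -leNgt ltW //.
  apply: sP => A As /=; rewrite circE.
  suff : phi L (phi E A) = phi E A.
    move=> /(congr1 (@^~ 0)); rewrite {1}/phi /= shiftset0 => ->.
    by rewrite /phi /= shiftset0.
  case: (imE A) => [->|->|[K [x [mK EA]]]]; [exact: phi_set0|exact: phi_setT|].
  rewrite EA phi_shift LB // /B asboolF // => KK0; apply: cK0.
  by exists n => //; exists A => //; rewrite EA negset_shift repP.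
have := congr1 (fun M : set_type I => phi (val M) (twin_rep K0)) EL.
rewrite /= phi_circ E1 // LB // /B asboolT // => /esym; exact: setC_neq.
Qed.

End MinimalLeftIdeals.

(** * Uncountable families of 2-cogroups *)

Section Independence.
Variable X : zmodType.
Implicit Types (A B H K : set X) (x y : X).

Lemma generated_subgroup B : subgroup (generated B).
Proof.
apply/subgroupP; split=> [H [sH _]|x y hx hy H [sH BH]]; first exact: subgroup0.
by apply: subgroupB => //; [exact: hx|exact: hy].
Qed.

Lemma subset_generated B : B `<=` generated B.
Proof. by move=> x Bx H [_]; exact. Qed.

Lemma generated_subset B H : subgroup H -> B `<=` H -> generated B `<=` H.
Proof. by move=> sH BH x; apply; split. Qed.

Lemma generatedS A B : A `<=` B -> generated A `<=` generated B.
Proof.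
move=> AB; apply: generated_subset; first exact: generated_subgroup.
exact: subset_trans (@subset_generated B).
Qed.

Lemma subgroup_set0 : subgroup [set (0 : X)].
Proof. by apply/subgroupP; split=> // x y -> ->; rewrite subrr. Qed.

Lemma independent_set0 : independent (set0 : set X).
Proof.
split=> // B C B0 _ _; rewrite eqEsubset; split=> x; last first.
  by move=> ->; split; apply: subgroup0; exact: generated_subgroup.
by case=> /(generated_subset subgroup_set0 (subset_trans B0 (@sub0set _ _))).
Qed.

Lemma independentS A B : A `<=` B -> independent B -> independent A.
Proof.
move=> AB [B0 hB]; split=> [/AB//|P Q PA QA].
by apply: hB; exact: subset_trans AB.
Qed.

(** A finite independent part of [E] is never maximal, so one more element can always be
    appended. *)
Lemma infinite_independent (E : set X) :
  ~ (exists2 A, maximal_independent_in E A & finite_set A) ->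
  exists x : nat -> X, [/\ forall n, E (x n), injective x
    & forall n, independent [set x i | i in `I_n]].
Proof.
move=> nE.
have next (s : seq X) : [set` s] `<=` E -> independent [set` s] ->
    exists x, [/\ E x, x \notin s & independent [set` rcons s x]].
  move=> sE si; apply: contrapT => nx; apply: nE.
  exists [set` s]; last exact: finite_seq.
  split=> // B BE iB sB; rewrite eqEsubset; split=> // x Bx.
  apply: contrapT => /negP xs; apply: nx; exists x; split=> //; first exact: BE.
  apply: independentS iB => y /=; rewrite mem_rcons inE => /predU1P[->//|].
  exact: sB.
pose g s := xget 0 [set x | [/\ E x, x \notin s & independent [set` rcons s x]]].
pose st n := iter n (fun s => rcons s (g s)) [::].
pose x n := g (st n).
have stE n : st n = mkseq x n.
  by elim: n => //= n IH; rewrite -/(st n) {1}IH mkseqS.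
have P n : [/\ [set` st n] `<=` E, independent [set` st n]
    & [/\ E (x n), x n \notin st n & independent [set` rcons (st n) (x n)]]].
  have gP s := @xgetPex _ 0 [set x | [/\ E x, x \notin s & independent [set` rcons s x]]].
  elim: n => [|n [sE si [Ex xs ix]]].
    have s0 : [set` [::]] = set0 :> set X by apply/funext => y; apply/propext.
    have h1 : [set` [::]] `<=` E by rewrite s0; exact: sub0set.
    have h2 : independent [set` ([::] : seq X)] by rewrite s0; exact: independent_set0.
    by split=> //; exact/gP/next.
  have h1 : [set` st n.+1] `<=` E.
    by move=> y /=; rewrite mem_rcons inE => /predU1P[->//|]; exact: sE.
  by split=> //; exact/gP/next.
have xN m n : (m < n)%N -> x m <> x n.
  move=> mn E'; have [_ _ [_ /negP + _]] := P n; apply.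
  by rewrite -E' stE; apply/mapP; exists m; rewrite ?mem_iota.
exists x; split=> [n|m n E'|n]; first by have [_ _ []] := P n.
  by case: (ltngtP m n) => // h; [have := xN _ _ h|have := xN _ _ h; rewrite E'].
have [_ + _] := P n; apply: independentS => _ [i /= ni <-].
by rewrite stE; apply/mapP; exists i; rewrite ?mem_iota.
Qed.

Lemma independent_sum (x : nat -> X) n (c : nat -> int) :
  injective x -> independent [set x i | i in `I_n] ->
  \sum_(i < n) x i *~ c i = 0 -> forall i, (i < n)%N -> x i *~ c i = 0.
Proof.
move=> xi [_ xI] c0 j jn.
suff : (generated [set x j] `&` generated (x @` (`I_n `\ j))) (x j *~ c j).
  rewrite xI; first by [].
  - by move=> _ ->; exists j.
  - by move=> _ [i [] /= ni _ <-]; exists i.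
  - by rewrite -subset0 => _ [-> [i [_ +] /xi]].
have sG B : subgroup (generated B) := @generated_subgroup B.
split; first by apply: (subgroupMz (c j) (sG _)); exact: subset_generated.
have -> : x j *~ c j = - \sum_(i < n | i != Ordinal jn) x i *~ c i.
  by apply/eqP; rewrite -addr_eq0; move: c0; rewrite (bigD1 (Ordinal jn)) //= => ->.
apply: (subgroupN (sG _)).
apply: big_rec => [|i y ij Gy]; first exact: subgroup0 (sG _).
apply: (subgroupD (sG _)) => //; apply: (subgroupMz (c i) (sG _)).
apply: subset_generated; exists i => //; split=> //= ijE.
by move/eqP: ij; apply; apply: val_inj.
Qed.

Lemma order_exists x n : (0 < n)%N -> x *+ n = 0 -> exists m, has_order x m.
Proof.
move=> n0 xn.
have h : exists n, (0 < n)%N && (x *+ n == 0) by exists n; rewrite n0 xn eqxx.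
case: (ex_minnP h) => m /andP[m0 /eqP xm] hm; exists m; split=> // p p0 xp.
by apply: hm; rewrite p0 xp eqxx.
Qed.

Lemma has_orderP x n m : has_order x n -> x *~ m = 0 -> (n %| `|m|)%N.
Proof.
move=> [n0 xn hn] xm.
have xm' : x *+ `|m|%N = 0.
  by case: m xm => // p; rewrite NegzE mulrNz => /eqP; rewrite oppr_eq0 => /eqP.
rewrite /dvdn; case: posnP => // r0.
have := hn _ r0; rewrite leqNgt ltn_mod n0 /= => h; exfalso.
have : x *+ (`|m| %% n)%N = 0; last by move/h.
by move: xm'; rewrite {1}(divn_eq `|m| n) mulrnDr mulnC mulrnA xn mul0rn add0r.
Qed.

Lemma infinite_orderP x m : infinite_order x -> x *~ m = 0 -> m = 0.
Proof.
move=> xi xm; apply/eqP; rewrite -absz_eq0; case: posnP => // m0.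
have xm' : x *+ `|m|%N = 0.
  by case: m xm {m0} => // p; rewrite NegzE mulrNz => /eqP; rewrite oppr_eq0 => /eqP.
by have [n] := order_exists m0 xm'; move/xi.
Qed.

Lemma two_power_order_even x m :
  two_power_order x -> x != 0 -> x *~ m = 0 -> ~~ odd `|m|.
Proof.
move=> [[|k] xk] x0 xm; first by case: xk => _; rewrite mulr1n => E; rewrite E eqxx in x0.
have := has_orderP xk xm; rewrite -dvdn2; apply: dvdn_trans.
by rewrite expnS dvdn_mulr.
Qed.

End Independence.

(** * Families of 2-cogroups indexed by binary sequences *)

Lemma uncountable_nat_bool (T : Type) (C : set T) (P : (nat -> bool) -> T -> Prop) :
  (forall S, exists2 K, C K & P S K) ->
  (forall S S' K, C K -> P S K -> P S' K -> S = S') -> ~ countable C.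
Proof.
move=> PC Pinj /countable_injP[f fi].
pose g S := projT1 (cid2 (PC S)).
have gC S : C (g S) by rewrite /g; case: cid2.
have gP S : P S (g S) by rewrite /g; case: cid2.
have fg S S' : f (g S) = f (g S') -> S = S'.
  move=> /fi E; have {}E : g S = g S' by apply: E; rewrite inE.
  by apply: (Pinj _ _ (g S)) => //; rewrite E.
(* Cantor's diagonal for the injection sending [S] to [f (g S)]. *)
pose D n := `[< exists2 S, f (g S) = n & ~~ S n >].
have DF : D (f (g D)) = false.
  by apply/negP => Dn; move: (Dn) => /asboolP[S /fg ->]; rewrite Dn.
by move/asboolPn: (DF); apply; exists D; rewrite ?DF.
Qed.

Lemma uncountable_cogroups (X : zmodType) (Q : (nat -> bool) -> set X) :
  (forall S, two_cogroup (Q S)) ->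
  (forall S S' n K, two_cogroup K -> Q S `<=` K -> Q S' `<=` K ->
     (forall m, (m < n)%N -> S m = S' m) -> S n -> ~~ S' n -> False) ->
  ~ countable (@maximal_two_cogroups X).
Proof.
move=> cQ sepQ; apply: (@uncountable_nat_bool _ _ (fun S K => Q S `<=` K)).
  by move=> S; exact: maximal_two_cogroup_ext.
move=> S S' K [cK _] SK S'K; apply: contrapT => nSS'.
have h : exists n, S n != S' n.
  apply: contrapT => nn; apply: nSS'; apply/funext => n; apply: contrapT => /eqP Sn.
  by apply: nn; exists n.
case: (ex_minnP h) => n Sn hn.
have lt m : (m < n)%N -> S m = S' m.
  by move=> mn; apply/eqP; apply: contraTT mn => /hn; rewrite leqNgt.
case S0 : (S n) Sn; case S1 : (S' n) => // _.
  by apply: (sepQ S S' n K); rewrite ?S0 ?S1.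
by apply: (sepQ S' S n K); rewrite ?S0 ?S1 // => m /lt.
Qed.

(** By hypothesis a weighted sum of the coefficients modulo 2 depends only on the combination; the
    combinations of weight 1 form the 2-cogroup [Q S]. *)
Lemma parity_independent_uncountable (X : zmodType) (x : nat -> X) :
  (forall n (c : nat -> int), \sum_(i < n) x i *~ c i = 0 ->
     forall i, (i < n)%N -> (c i)%:~R = 0 :> 'F_2) ->
  ~ countable (@maximal_two_cogroups X).
Proof.
move=> xI.
have F2 (a : 'F_2) : a + a = 0.
  by rewrite -mulr2n -mulr_natr (_ : 2%:R = 0 :> 'F_2) ?mulr0 //; apply/val_inj.
(* [x 0] has weight 1 for every [S], hence lies in every [Q S]; the digit [S j] is the weight of
   [x j.+1]. *)
pose w (S : nat -> bool) i : 'F_2 := if i is j.+1 then (S j)%:R else 1.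
pose par S n (c : nat -> int) := \sum_(i < n) (c i)%:~R * w S i.
pose comb n (c : nat -> int) := \sum_(i < n) x i *~ c i.
pose Q S := [set y | exists n c, y = comb n c /\ par S n c = 1].
have wide S n m c : (n <= m)%N -> exists d, comb n c = comb m d /\ par S n c = par S m d.
  move=> nm; exists (fun i => if (i < n)%N then c i else 0); split.
    rewrite /comb (big_ord_widen m (fun i => x i *~ c i) nm) [RHS](bigID (fun i : 'I_m => (i < n)%N)) /=.
    rewrite [X in _ = _ + X]big1 ?addr0 => [|i /negbTE -> //].
    by apply: eq_bigr => i ->.
  rewrite /par (big_ord_widen m (fun i => (c i)%:~R * w S i) nm) [RHS](bigID (fun i : 'I_m => (i < n)%N)) /=.
  rewrite [X in _ = _ + X]big1 ?addr0 => [|i /negbTE -> //]; last by rewrite mul0r.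
  by apply: eq_bigr => i ->.
have combD n c d : comb n c + comb n d = comb n (fun i => c i + d i).
  by rewrite /comb -big_split; apply: eq_bigr => i _; rewrite mulrzDr.
have parD S n c d : par S n c + par S n d = par S n (fun i => c i + d i).
  by rewrite /par -big_split; apply: eq_bigr => i _; rewrite intrD mulrDl.
have combN n c : - comb n c = comb n (fun i => - c i).
  by rewrite /comb -sumrN; apply: eq_bigr => i _; rewrite mulrNz.
have parN S n c : - par S n c = par S n (fun i => - c i).
  by rewrite /par -sumrN; apply: eq_bigr => i _; rewrite intrN mulNr.
have delta j S : exists n c, x j = comb n c /\ par S n c = w S j.
  exists j.+1, (fun i => (i == j)%:Z); split.
    rewrite /comb big_ord_recr /= eqxx mulr1z big1 ?add0r // => i _.
    by rewrite (ltn_eqF (ltn_ord i)).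
  rewrite /par big_ord_recr /= eqxx mul1r big1 ?add0r // => i _.
  by rewrite (ltn_eqF (ltn_ord i)) mul0r.
have x0Q S : Q S (x 0) by exact: delta.
have cQ S : two_cogroup (Q S).
  apply/two_cogroupP; split; first by exists (x 0).
  - move=> _ [n [c [-> c1]]]; exists n, (fun i => - c i); split; first exact: combN.
    by rewrite -parN c1; apply: (@addrI _ 1); rewrite subrr F2.
  - move=> _ _ _ [n [c [-> c1]]] [m [d [-> d1]]] [p [e [-> e1]]].
    pose q := maxn n (maxn m p).
    have [c' [-> cE]] := @wide S n q c (leq_maxl _ _).
    have [d' [-> dE]] : exists d', comb m d = comb q d' /\ par S m d = par S q d'.
      by apply: wide; rewrite /q leq_max leq_maxl orbT.
    have [e' [-> eE]] : exists e', comb p e = comb q e' /\ par S p e = par S q e'.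
      by apply: wide; rewrite /q !leq_max leqnn !orbT.
    exists q, (fun i => c' i + d' i + e' i); rewrite -!combD -!parD; split=> //.
    by rewrite -cE -dE -eE c1 d1 e1 F2 add0r.
  - move=> _ _ [n [c [-> c1]]] [m [d [-> d1]]] [p [e [E e1]]].
    pose q := maxn n (maxn m p).
    have [c' [cE cE']] := @wide S n q c (leq_maxl _ _).
    have [d' [dE dE']] : exists d', comb m d = comb q d' /\ par S m d = par S q d'.
      by apply: wide; rewrite /q leq_max leq_maxl orbT.
    have [e' [eE eE']] : exists e', comb p e = comb q e' /\ par S p e = par S q e'.
      by apply: wide; rewrite /q !leq_max leqnn !orbT.
    have : par S q (fun i => c' i + d' i - e' i) = 0.
      rewrite /par big1 // => i _; rewrite (xI q (fun i => c' i + d' i - e' i)) ?mul0r //.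
      change (comb q (fun i => c' i + d' i - e' i) = 0).
      by rewrite -!combD -combN -cE -dE -eE E subrr.
    rewrite -!parD -parN -cE' -dE' -eE' c1 d1 e1 F2 add0r => /eqP.
    by rewrite oppr_eq0.
apply: (uncountable_cogroups cQ) => S S' n K cK SK S'K _ Sn S'n.
have [_ _ _ KD] := (two_cogroupP K).1 cK.
(* [x n.+1] has weight 1 for [S] and 0 for [S'], so adding [x 0] gives weight 1 for [S']: [K] would
   contain two elements and their sum. *)
apply: (KD (x n.+1) (x 0)).
- by apply: SK; have := delta n.+1 S; rewrite /= Sn.
- exact: SK.
- apply: S'K; have [m [c [-> cE]]] := delta n.+1 S'.
  have [p [d [-> dE]]] := delta 0%N S'.
  have [c' [-> cE']] := @wide S' m (maxn m p) c (leq_maxl _ _).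
  have [d' [-> dE']] := @wide S' p (maxn m p) d (leq_maxr _ _).
  exists (maxn m p), (fun i => c' i + d' i); rewrite combD -parD; split=> //.
  by rewrite -cE' -dE' cE dE /= (negbTE S'n) add0r.
Qed.

(** One statement serves both ranks: infinite order is killed only by 0, nontrivial 2-power order
    only by even integers. So relations between independent elements have even coefficients. *)
Lemma finite_rank (X : zmodType) (E : set X) :
  (forall x m, E x -> x != 0 -> x *~ m = 0 -> ~~ odd `|m|) ->
  countable (@maximal_two_cogroups X) ->
  exists2 A, maximal_independent_in E A & finite_set A.
Proof.
move=> Eeven cX; apply: contrapT => /infinite_independent[x [xE xi xI]].
apply: (@parity_independent_uncountable X x) cX => n c c0 i ni.
have x0 : x i != 0.
  by apply/eqP => x0; have [+ _] := xI i.+1; apply; exists i => /=.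
have := Eeven _ _ (xE i) x0 (independent_sum xi (xI n) c0 ni).
rewrite -dvdn2 => /dvdnP[q qE].
have F2 : 2%:R = 0 :> 'F_2 by apply/val_inj.
have nat0 : (`|c i|%N)%:R = 0 :> 'F_2 by rewrite qE natrM F2 mulr0.
by case: (c i) nat0 => // p; rewrite NegzE intrN => h; apply/eqP; rewrite oppr_eq0; apply/eqP.
Qed.

(** * The quasicyclic group and its 2-adic multipliers *)

Section Quasicyclic.
Variable R : realType.
Notation C := (quasicyclic2 R).

Lemma qc2_val_inj : injective (@qc2_val R).
Proof. exact: val_inj. Qed.

Lemma qc2_valMn (z : C) n : qc2_val (z *+ n) = qc2_val z ^+ n.
Proof. by elim: n => [//|n IH]; rewrite mulrS exprS -IH. Qed.

Lemma qc2_torsion (z : C) : exists k, z *+ (2 ^ k)%N = 0.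
Proof.
have /asboolP[k _ zk] := qc2_valP z; exists k.
by apply: qc2_val_inj; rewrite qc2_valMn.
Qed.

Lemma in_qc2N1 : in_quasicyclic2 (-1 : R[i]).
Proof. by apply/asboolP; exists 1%N => //; rewrite expn1 sqrrN expr1n. Qed.

Definition qc2_half : C := Quasicyclic2 in_qc2N1.

Lemma qc2_half_neq0 : qc2_half != 0.
Proof.
apply/eqP => /(congr1 (@qc2_val R)) /= /eqP.
by rewrite eq_sym -subr_eq0 opprK -mulr2n pnatr_eq0.
Qed.

Lemma qc2_half_dbl : qc2_half *+ 2 = 0.
Proof. by apply: qc2_val_inj; rewrite qc2_valMn /= sqrrN expr1n. Qed.

Lemma qc2_halves (z : C) : z *+ 2 = 0 -> z = 0 \/ z = qc2_half.
Proof.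
move=> /(congr1 (@qc2_val R)); rewrite qc2_valMn => /eqP; rewrite -[X in _ == X]/1.
by rewrite sqrf_eq1 => /orP[]/eqP zE; [left|right]; apply: qc2_val_inj.
Qed.

Lemma qc2_div2 (z : C) : exists w : C, w *+ 2 = z.
Proof.
have /asboolP[k k1 zk] := qc2_valP z.
have wP : in_quasicyclic2 (sqrtC (qc2_val z)).
  by apply/asboolP; exists k.+1 => //; rewrite expnS exprM sqrtCK.
by exists (Quasicyclic2 wP); apply: qc2_val_inj; rewrite qc2_valMn /= sqrtCK.
Qed.

Lemma qc2_div_half k : exists w : C, w *+ (2 ^ k)%N = qc2_half.
Proof.
elim: k => [|k [w wE]]; first by exists qc2_half; rewrite mulr1n.
by have [v vE] := qc2_div2 w; exists v; rewrite expnS mulrnA vE.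
Qed.

(** Another element of a larger 2-cogroup [L] would have order at least 4, making [qc2_half] an even
    multiple of it and so an element of both [cobase L] and [L]. *)
Lemma qc2_maximal_cogroup : maximal_two_cogroups [set qc2_half].
Proof.
have hh : qc2_half + qc2_half = 0 by rewrite -mulr2n qc2_half_dbl.
have cK : two_cogroup [set qc2_half].
  apply/two_cogroupP; split; first by exists qc2_half.
  - by move=> _ ->; apply: (@addrI _ qc2_half); rewrite subrr hh.
  - by move=> _ _ _ -> -> ->; rewrite hh add0r.
  - by move=> _ _ -> ->; rewrite hh => /esym /eqP; rewrite (negbTE qc2_half_neq0).
split=> // L cL KL; rewrite eqEsubset; split=> // y Ly.
have hy := qc2_torsion y.
have {}hy : exists k, y *+ (2 ^ k)%N == 0 by case: hy => k /eqP; exists k.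
case: (ex_minnP hy) => -[|k] /eqP yk kmin.
  by exfalso; apply: (cogroup0 cL); move: yk; rewrite mulr1n => <-.
have yk2 : (y *+ (2 ^ k)%N) *+ 2 = 0 by rewrite -mulrnA -expnSr.
case: (qc2_halves yk2) => [/eqP /kmin|yh]; first by rewrite ltnn.
case: k yk kmin yk2 yh => [|k] _ _ _ yh; first by move: yh; rewrite mulr1n.
exfalso; apply: (@cobaseF _ _ cL qc2_half); last exact: KL.
by rewrite -yh; apply: cobase_even => //; rewrite expnS oddM.
Qed.

(** [qc2_dyadic_mul S] is the multiplication by the 2-adic integer with digits [S]. *)
Definition dyadic (S : nat -> bool) k : nat := (\sum_(i < k) S i * 2 ^ i)%N.

Definition qc2_dyadic_mul (S : nat -> bool) (z : C) : C :=
  z *+ dyadic S (projT1 (cid (qc2_torsion z))).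

(** The digits from [k] on contribute multiples of [2 ^ k], which kill [z]. *)
Lemma qc2_dyadic_mulE S z k : z *+ (2 ^ k)%N = 0 -> qc2_dyadic_mul S z = z *+ dyadic S k.
Proof.
rewrite /qc2_dyadic_mul; case: cid => l /= zl zk.
wlog kl : k l zk zl / (k <= l)%N.
  by move=> W; case: (leqP k l) => [|/ltnW] kl; [exact: W|rewrite (W l k)].
rewrite -(subnKC kl); elim: (l - k)%N => [|d IH]; first by rewrite addn0.
rewrite addnS {1}/dyadic big_ord_recr /= mulrnDr -/(dyadic S (k + d)) IH.
by rewrite mulnC expnD -mulnA mulrnA zk mul0rn addr0.
Qed.

Lemma qc2_dyadic_mulD S : {morph qc2_dyadic_mul S : u v / u + v}.
Proof.
move=> u v; have [k uk] := qc2_torsion u; have [l vl] := qc2_torsion v.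
have ukl : u *+ (2 ^ (k + l))%N = 0 by rewrite expnD mulrnA uk mul0rn.
have vkl : v *+ (2 ^ (k + l))%N = 0 by rewrite addnC expnD mulrnA vl mul0rn.
by rewrite !(@qc2_dyadic_mulE S _ (k + l)%N) ?mulrnDl ?ukl ?vkl ?addr0.
Qed.

Lemma qc2_dyadic_mulN S u : qc2_dyadic_mul S (- u) = - qc2_dyadic_mul S u.
Proof.
have [k uk] := qc2_torsion u.
by rewrite !(@qc2_dyadic_mulE S _ k) ?mulNrn ?uk ?oppr0.
Qed.

(** [Q S] is the preimage under [f] of the graph of the multiplication by [S], translated by the
    element of order two. *)
Lemma epimorphism_uncountable (X : zmodType) (f : {additive X -> C * C}) :
  set_surj setT setT f -> ~ countable (@maximal_two_cogroups X).
Proof.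
move=> fsurj; have fs p : exists x, f x = p by have [x _] := fsurj p I; exists x.
have hh : qc2_half + qc2_half = 0 by rewrite -mulr2n qc2_half_dbl.
have hN : - qc2_half = qc2_half by apply: (@addrI _ qc2_half); rewrite subrr hh.
pose h := qc2_half; rewrite -/h in hh hN.
pose Q S := [set x | (f x).1 = qc2_dyadic_mul S (f x).2 + h].
have mul0 S : qc2_dyadic_mul S 0 = 0 by rewrite (@qc2_dyadic_mulE S 0 0) ?mul0rn.
have cQ S : two_cogroup (Q S).
  apply/two_cogroupP; split.
  - by have [x xE] := fs (h, 0); exists x; rewrite /Q /= xE /= mul0 add0r.
  - by move=> a /= Qa; rewrite /Q /= !raddfN /= Qa qc2_dyadic_mulN opprD hN.
  - move=> a b c /= Qa Qb Qc; rewrite /Q /= !raddfD /= Qa Qb Qc !qc2_dyadic_mulD.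
    by rewrite (addrACA (qc2_dyadic_mul _ _)) hh addr0 addrA.
  - move=> a b /= Qa Qb; rewrite /Q /= !raddfD /= Qa Qb !qc2_dyadic_mulD.
    rewrite (addrACA (qc2_dyadic_mul _ _)) => /addrI; rewrite hh => /esym /eqP.
    by rewrite (negbTE qc2_half_neq0).
apply: (uncountable_cogroups cQ) => S S' n K cK SK S'K lt Sn S'n.
(* As [n] is the first differing digit and [v *+ 2 ^ n] is the half, [S] and [S'] send [v] to values
   differing by [h]. So [a] in [Q S] and [b] in [Q S'] over [v] have a difference with image
   [(h, 0)], again in [Q S]. *)
have [v vE] := qc2_div_half n.
have v0 : v *+ (2 ^ n.+1)%N = 0 by rewrite expnSr mulrnA vE qc2_half_dbl.
have vS : qc2_dyadic_mul S v = qc2_dyadic_mul S' v + qc2_half.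
  rewrite !(qc2_dyadic_mulE _ v0) /dyadic !big_ord_recr /= Sn (negbTE S'n) mul1n mul0n addn0.
  rewrite mulrnDr vE; congr (_ *+ _ + _); apply: eq_bigr => i _.
  by rewrite lt.
have [a aE] := fs (qc2_dyadic_mul S v + h, v).
have [b bE] := fs (qc2_dyadic_mul S' v + h, v).
have Ka : K a by apply: SK; rewrite /Q /= aE.
have Kb : K b by apply: S'K; rewrite /Q /= bE.
apply: (@cobaseF _ _ cK (a - b)); first exact: cobaseB.
apply: SK; rewrite /Q /= raddfB aE bE /= vS subrr mul0 add0r -/h.
by rewrite opprD addrACA subrr addr0 addrAC subrr add0r.
Qed.

End Quasicyclic.

Lemma countable_cogroups_rank (R : realType) (X : zmodType) :
  countable (@maximal_two_cogroups X) ->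
  [/\ ~ (exists f : {additive X -> quasicyclic2 R * quasicyclic2 R},
            set_surj setT setT f),
      finite_free_rank X
    & finite_two_rank X].
Proof.
move=> cX; split.
- by move=> [f fs]; exact: (epimorphism_uncountable fs cX).
- apply: finite_rank cX => x m xi _ /(infinite_orderP xi) ->.
  by [].
- by apply: finite_rank cX => x m; exact: two_power_order_even.
Qed.

(** * Finitely generated subgroups and ranks *)

Section Span.
Variable X : zmodType.
Implicit Types (A B E H K N U : set X) (x y z : X) (s : seq X).

Lemma generated_setU1 A P x y : P `<=` A `|` [set x] -> generated P y ->
  exists p m, [/\ generated (P `&` A) p, y = p + x *~ m & ~ P x -> m = 0].
Proof.
move=> PA; pose H := [set y | exists p m,
  [/\ generated (P `&` A) p, y = p + x *~ m & ~ P x -> m = 0]].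
have sG B : subgroup (generated B) := @generated_subgroup _ B.
apply: (@generated_subset _ _ H).
  apply/subgroupP; split.
    by exists 0, 0; split=> //; [exact: subgroup0 (sG _)|rewrite mulr0z addr0].
  move=> _ _ [p [m [Gp -> m0]]] [q [n [Gq -> n0]]]; exists (p - q), (m - n).
  split; [exact: (subgroupB (sG _))| |by move=> nP; rewrite m0 // n0 // subr0].
  by rewrite mulrzBr; zmod.
move=> z Pz; case: (PA z Pz) => [Az|zx].
  by exists z, 0; split=> //; [exact: subset_generated|rewrite mulr0z addr0].
exists 0, 1; split; first exact: subgroup0 (sG _).
  by rewrite mulr1z add0r.
by rewrite -zx.
Qed.

(** Otherwise [x] could be added to [A]: of two disjoint parts of the enlarged set only one contains
    [x], and its multiple there falls in [generated A], hence vanishes. *)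
Lemma maximal_independent_dep E A x :
  maximal_independent_in E A -> E x -> x != 0 ->
  exists m : int, generated A (x *~ m) /\ x *~ m != 0.
Proof.
move=> [AE [A0 iA] mA] Ex x0; apply: contrapT => nm.
have sG B : subgroup (generated B) := @generated_subgroup _ B.
have free m : generated A (x *~ m) -> x *~ m = 0.
  by move=> Gm; apply: contrapT => /eqP xm; apply: nm; exists m.
have Ax : ~ A x.
  move=> Ax; move/eqP: x0; apply; rewrite -[x]mulr1z; apply: free.
  by rewrite mulr1z; exact: subset_generated.
apply: Ax; rewrite -(mA (A `|` [set x])); last 3 first.
- by move=> z [/AE//|->].
- split=> [[//|/esym/eqP]|P Q PA QA PQ]; first by rewrite (negbTE x0).
  rewrite eqEsubset; split=> y; last by move=> ->; split; exact: subgroup0 (sG _).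
  case=> /(generated_setU1 PA)[p [m [Gp yp m0]]] /(generated_setU1 QA)[q [n [Gq yq n0]]].
  have GA B z : generated (B `&` A) z -> generated A z.
    exact: (generatedS (@subIsetr _ _ _)).
  have E0 : x *~ (m - n) = 0.
    apply: free; rewrite mulrzBr.
    have -> : x *~ m - x *~ n = q - p.
      have -> : x *~ m = y - p by rewrite yp; zmod.
      by rewrite {1}yq; zmod.
    exact: (subgroupB (sG _) (GA _ _ Gq) (GA _ _ Gp)).
  have xm : x *~ m = 0.
    have [Px|/m0 ->] := pselect (P x); last by rewrite mulr0z.
    have Qx : ~ Q x by move=> Qx; have : (P `&` Q) x by []; rewrite PQ.
    by rewrite -E0 (n0 Qx) subr0.
  have xn : x *~ n = 0.
    by move: E0; rewrite mulrzBr xm sub0r => /eqP; rewrite oppr_eq0 => /eqP.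
  have yP : y = p by rewrite yp xm addr0.
  have yQ : y = q by rewrite yq xn addr0.
  have : (generated (P `&` A) `&` generated (Q `&` A)) y.
    by split; [rewrite yP|rewrite yQ].
  rewrite iA; [by []|exact: subIsetr|exact: subIsetr|].
  by rewrite setIACA PQ set0I.
- exact: subsetUl.
- by right.
Qed.

Fixpoint zspan s : set X :=
  if s is a :: s' then [set x | exists m : int, zspan s' (x - a *~ m)]
  else [set 0].

Lemma span_subgroup s : subgroup (zspan s).
Proof.
elim: s => [|a s IH] /=; first exact: subgroup_set0.
apply/subgroupP; split; first by exists 0; rewrite mulr0z subr0; exact: subgroup0.
move=> x y [m hx] [n hy]; exists (m - n).
have -> : x - y - a *~ (m - n) = x - a *~ m - (y - a *~ n) by rewrite mulrzBr; zmod.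
exact: subgroupB.
Qed.

Lemma mem_span s a : a \in s -> zspan s a.
Proof.
elim: s => // b s IH; rewrite inE => /predU1P[->|/IH sa] /=.
  by exists 1; rewrite mulr1z subrr; exact: subgroup0 (span_subgroup s).
by exists 0; rewrite mulr0z subr0.
Qed.

Lemma generated_span s : generated [set` s] `<=` zspan s.
Proof. by apply: generated_subset; [exact: span_subgroup|move=> a; exact: mem_span]. Qed.

Lemma span_finite s : (forall a, a \in s -> exists2 n, (0 < n)%N & a *+ n = 0) ->
  exists l : seq X, forall x, zspan s x -> x \in l.
Proof.
elim: s => [|a s IH] tors; first by exists [:: 0] => x ->; rewrite mem_head.
have [|l hl] := IH; first by move=> b bs; apply: tors; rewrite inE bs orbT.
have [n n0 an] := tors a (mem_head _ _).
exists [seq z + a *+ j | z <- l, j <- iota 0 n] => x [m /hl xl].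
apply/allpairsP; exists (x - a *~ m, `|(m %% n)%Z|%N); split=> //=.
  rewrite mem_iota /= add0n -ltz_nat gez0_abs ?modz_ge0 ?ltz_pmod //.
  by rewrite -lt0n.
rewrite pmulrn gez0_abs ?modz_ge0 -?lt0n //.
rewrite {1}(divz_eq m n) mulrzDr mulrC mulrzA -[X in X *~ (_ %/ _)%Z]pmulrn an mul0rz.
by rewrite add0r subrK.
Qed.

Lemma mulrz_divz2 x (m : int) : x *~ m = x *~ (m %/ 2)%Z *+ 2 + x *~ (m %% 2)%Z.
Proof.
by rewrite {1}(divz_eq m 2) mulrzDr mulr_natr mulr2n mulrzDr -mulr2n.
Qed.

Lemma span_halves s : exists l : seq X, forall y, zspan s y ->
  exists y0 z, [/\ y0 \in l, zspan s z & y = y0 + z *+ 2].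
Proof.
elim: s => [|a s [l hl]].
  by exists [:: 0] => y ->; exists 0, 0; rewrite mem_head mul0rn addr0.
exists [seq z + a *~ j | z <- l, j <- [:: 0; 1]] => y [m /hl [y0 [z [yl sz yE]]]].
exists (y0 + a *~ (m %% 2)%Z), (z + a *~ (m %/ 2)%Z); split.
- apply/allpairsP; exists (y0, (m %% 2)%Z); split=> //.
  have := ltz_pmod m (isT : (0 < 2 :> int)); have := modz_ge0 m (isT : (2 != 0 :> int)).
  by rewrite /= !inE; lia.
- by exists (m %/ 2)%Z; rewrite addrK.
- by rewrite -[y](subrK (a *~ m)) yE (mulrz_divz2 a m); zmod.
Qed.

Lemma free_rank_torsion : finite_free_rank X ->
  exists s, forall x, exists2 q, (0 < q)%N & zspan s (x *+ q).
Proof.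
move=> [A mA /finite_seqP[s As]]; exists s => x.
have [xi|/existsNP[n /contrapT [n0 xn _]]] := pselect (infinite_order x); last first.
  by exists n => //; rewrite xn; exact: subgroup0 (span_subgroup s).
have x0 : x != 0.
  by apply/eqP => x0; apply: (xi 1%N); split.
have [m [Gm xm]] := maximal_independent_dep mA xi x0.
have m0 : m != 0 by apply: contraNN xm => /eqP ->; rewrite mulr0z.
exists `|m|%N; first by rewrite absz_gt0.
move: Gm; rewrite As => /generated_span sm.
case: (m) sm => p //; rewrite NegzE mulrNz => /(subgroupN (span_subgroup s)).
by rewrite opprK.
Qed.

Lemma two_rank_finite : finite_two_rank X ->
  exists s : seq X, forall x, x *+ 2 = 0 -> x \in s.
Proof.
move=> [A mA /finite_seqP[s As]].
have [a|l hl] := @span_finite s.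
  move=> as_; have [AE _ _] := mA; have [|k [n0 ak _]] := AE a; first by rewrite As.
  by exists (2 ^ k)%N.
exists (0 :: l) => x x2; rewrite inE; case: (eqVneq x 0) => //= x0; apply: hl.
have Ex : two_power_order x.
  exists 1%N; split=> // -[|[|m]] // _; rewrite mulr1n => xE.
  by rewrite xE eqxx in x0.
(* As [x] has order two, its nonzero multiple [x *~ m] is [x] itself. *)
have [m [Gm xm]] := maximal_independent_dep mA Ex x0.
have E2 : x *~ m = x *~ (m %% 2)%Z.
  by rewrite mulrz_divz2 pmulrn -mulrzA mulrC mulrzA -pmulrn x2 mul0rz add0r.
have m1 : (m %% 2)%Z = 1.
  have : (m %% 2)%Z != 0 by apply: contraNN xm => /eqP m0; rewrite E2 m0 mulr0z.
  have := ltz_pmod m (isT : (0 < 2 :> int)); have := modz_ge0 m (isT : (2 != 0 :> int)).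
  lia.
apply: generated_span; move: Gm; rewrite E2 m1 mulr1z As.
by [].
Qed.

End Span.

(** * Characters with values in the quasicyclic group *)

Section Characters.
Variables (R : realType) (X : zmodType) (K : set X).
Hypothesis mK : maximal_two_cogroups K.
Notation C := (quasicyclic2 R).
Notation h := (qc2_half R).
Let N := cobase K.
Let cK : two_cogroup K. Proof. by case: mK. Qed.
Let sN : subgroup N. Proof. exact: cobase_subgroup. Qed.

(** If [x *+ 2 ^ j] is outside [N], the last of its successive doubles outside [N] has order two
    modulo [N], hence lies in [K]. *)
Lemma maximal_cogroup_exponent (V : set X) : subgroup V ->
  (exists j, forall x, V x -> N (x *+ (2 ^ j)%N)) \/
  forall j, exists2 x, V x & K (x *+ (2 ^ j)%N).
Proof.
move=> sV; have [Vj|nV] := pselect (exists j, forall x, V x -> N (x *+ (2 ^ j)%N)).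
  by left.
right=> j; have [x Vx nN] : exists2 x, V x & ~ N (x *+ (2 ^ j)%N).
  apply: contrapT => nx; apply: nV; exists j => x Vx.
  by apply: contrapT => nNx; apply: nx; exists x.
have h0 : exists k, `[< N (x *+ (2 ^ j)%N *+ (2 ^ k)%N) >].
  by have [k Nk] := maximal_cogroup_2power mK (x *+ (2 ^ j)%N); exists k; apply/asboolP.
case: (ex_minnP h0) => -[|k] /asboolP Nk kmin; first by rewrite mulr1n in Nk.
exists (x *+ (2 ^ k)%N); first exact: subgroupMn.
have [|Nk'|//] := maximal_cogroup_halves mK (x := x *+ (2 ^ k)%N *+ (2 ^ j)%N).
  by move: Nk; rewrite expnSr mulrnA (mulrnAC x).
have /kmin : `[< N (x *+ (2 ^ j)%N *+ (2 ^ k)%N) >]; last by rewrite ltnn.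
by apply/asboolP; rewrite mulrnAC.
Qed.

Lemma cobase_qc2_half (z : C) : cobase [set h] z -> z = 0.
Proof. by move=> [_ [_ [-> -> ->]]]; rewrite -mulr2n qc2_half_dbl. Qed.

(** The graph of the character is the base of a maximal 2-cogroup of [X * C],
    which replaces the injectivity of the quasicyclic group. *)
Lemma cogroup_character : exists f : {additive X -> C},
  (forall x, f x = 0 <-> N x) /\ (forall x, K x -> f x = h).
Proof.
have hh : h + h = 0 by rewrite -mulr2n qc2_half_dbl.
have hN : - h = h by apply: (@addrI _ h); rewrite subrr hh.
(* [B] is the graph of the character on [N] and [K] that is [h] on [K]; [K0] is its translate by
   [(0, h)]. *)
pose K0 := [set p : X * C | (K p.1 /\ p.2 = 0) \/ (N p.1 /\ p.2 = h)].
pose B := [set p : X * C | (N p.1 /\ p.2 = 0) \/ (K p.1 /\ p.2 = h)].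
have KK p q : K0 p -> K0 q -> B (p + q).
  case: p q => [x z] [y t] [[/= Kx ->]|[/= Nx ->]] [[/= Ky ->]|[/= Ny ->]].
  - by left; rewrite /= addr0; split=> //; exact: cobaseD.
  - by right; rewrite /= add0r; split=> //; exact: cogroupDl.
  - by right; rewrite /= addr0; split=> //; rewrite addrC; exact: cogroupDl.
  - by left; rewrite /= hh; split=> //; exact: subgroupD.
have BK p q : B p -> K0 q -> K0 (p + q).
  case: p q => [x z] [y t] [[/= Kx ->]|[/= Nx ->]] [[/= Ky ->]|[/= Ny ->]].
  - by left; rewrite /= addr0; split=> //; rewrite addrC; exact: cogroupDl.
  - by right; rewrite /= add0r; split=> //; exact: subgroupD.
  - by right; rewrite /= addr0; split=> //; exact: cobaseD.
  - by left; rewrite /= hh; split=> //; exact: cogroupDl.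
have [k Kk] := cogroup_ex cK.
have cK0 : two_cogroup K0.
  apply/two_cogroupP; split; first by exists (k, 0); left.
  - move=> [x z] [[/= Kx ->]|[/= Nx ->]].
      by left; rewrite /= oppr0; split=> //; exact: cogroupN.
    by right; rewrite /= hN; split=> //; exact: subgroupN.
  - by move=> a b c Ka Kb Kc; apply: BK => //; exact: KK.
  - move=> a b Ka Kb; have := KK _ _ Ka Kb.
    case=> [[Nx z0]|[Kx zh]] [[Kx' z0']|[Nx' zh']].
    + exact: cobaseF Nx Kx'.
    + by move: zh'; rewrite z0 => /esym/eqP; rewrite (negbTE (qc2_half_neq0 R)).
    + by move: z0'; rewrite zh => /eqP; rewrite (negbTE (qc2_half_neq0 R)).
    + exact: cobaseF Nx' Kx.
have [M mM K0M] := maximal_two_cogroup_ext cK0.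
have cM : two_cogroup M by case: mM.
have sM : subgroup (cobase M) := cobase_subgroup cM.
have M0h : M (0, h) by apply: K0M; right; split=> //; exact: subgroup0.
have pairMn (p : X * C) n : p *+ n = (p.1 *+ n, p.2 *+ n).
  by elim: n => [//|n IH]; rewrite mulrS IH !mulrS.
have pairMz (p : X * C) (m : int) : p *~ m = (p.1 *~ m, p.2 *~ m).
  by case: m => n; rewrite ?NegzE ?mulrNz -?pmulrn pairMn.
(* [(0, w)] has order [2 ^ j.+1] modulo [cobase M], so some multiple of it is congruent to
   [(x, 0)]. *)
have ex x : exists z, cobase M (x, z).
  have [j Nj] := maximal_cogroup_2power mM (x, 0).
  have [w wE] := qc2_div_half R j.
  have [||m Nm] := maximal_cogroup_cyclic mM (j := j) (x := (0, w)) (y := (x, 0)).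
  - by rewrite pairMn /= mul0rn wE.
  - by rewrite expnSr mulrnA; exact: subgroupMn.
  exists (- (w *+ m)); move: Nm; rewrite pairMn /= mul0rn.
  by congr (cobase M (_, _)); rewrite ?subr0 ?add0r.
(* A nonzero [z] has [h] as a multiple, which would put [(0, h)] in both [cobase M] and [M]. *)
have uniq0 z : cobase M (0, z) -> z = 0.
  move=> Nz; apply: contrapT => z0.
  have [|m zm] := maximal_cogroup_mul (qc2_maximal_cogroup R) (x := z).
    by move/cobase_qc2_half.
  apply: (cobaseF cM) M0h; rewrite -[h]zm.
  have -> : (0, z *~ m) = (0, z) *~ m :> X * C by rewrite pairMz /= mul0rz.
  exact: subgroupMz.
pose f x := projT1 (cid (ex x)).
have fP x : cobase M (x, f x) by rewrite /f; case: cid.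
have fE x z : cobase M (x, z) -> f x = z.
  move=> Nz; apply/eqP; rewrite -subr_eq0; apply/eqP/uniq0.
  have -> : (0, f x - z) = (x, f x) - (x, z) :> X * C by congr (_, _); rewrite subrr.
  exact: subgroupB.
have fB : {morph f : x y / x - y}.
  by move=> x y; apply: fE; exact: subgroupB (fP x) (fP y).
pose F : {additive X -> C} := HB.pack f (GRing.isZmodMorphism.Build _ _ f fB).
exists F; split=> [x|x Kx]; last first.
  apply: fE; have -> : (x, h) = (x, 0) + (0, h) :> X * C by congr (_, _); rewrite ?addr0 ?add0r.
  by apply: cobaseD => //; apply: K0M; left.
split=> [fx0|[a [b [Ka Kb ->]]]]; last first.
  apply: fE; have -> : (a + b, 0) = (a, 0) + (b, 0) :> X * C by congr (_, _); rewrite addr0.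
  by apply: cobaseD => //; apply: K0M; left.
apply: contrapT => Nx; have [m Km] := maximal_cogroup_mul mK Nx.
apply: (@cobaseF _ _ cM (x *~ m, 0)); last by apply: K0M; left.
have <- : F (x *~ m) = 0 by rewrite raddfMz fx0 mul0rz.
exact: fP.
Qed.

(** If [x *+ 2 ^ j] is in [K], its character value has order [2 ^ j.+1] and generates all the
    [2 ^ j.+1]-torsion of [C]. *)
Lemma cogroup_epimorphism :
  (forall j, exists x, K (x *+ (2 ^ j)%N)) ->
  exists f : {additive X -> C},
    (forall x, f x = 0 <-> N x) /\ (forall z, exists x, f x = z).
Proof.
move=> qK; have [f [fN fK]] := cogroup_character; exists f; split=> // z.
have [j zj] := qc2_torsion z; have [x Kx] := qK j.
have [||m] := maximal_cogroup_cyclic (qc2_maximal_cogroup R) (j := j) (x := f x) (y := z).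
- by rewrite -raddfMn /=; exact: fK.
- rewrite expnSr mulrnA zj mul0rn; exact: subgroup0 (cobase_subgroup (qc2_maximal_cogroup R).1).
move/cobase_qc2_half => /eqP; rewrite subr_eq0 => /eqP ->.
by exists (x *+ m); rewrite raddfMn.
Qed.

End Characters.

Lemma cogroups_commensurable (R : realType) (X : zmodType) (K K' : set X) :
  ~ (exists f : {additive X -> quasicyclic2 R * quasicyclic2 R},
       set_surj setT setT f) ->
  maximal_two_cogroups K -> maximal_two_cogroups K' ->
  (forall j, exists x, K (x *+ (2 ^ j)%N)) ->
  (forall j, exists x, K' (x *+ (2 ^ j)%N)) ->
  exists k, forall x, cobase K' x -> cobase K (x *+ (2 ^ k)%N).
Proof.
move=> nepi mK mK' qK qK'.
have sN := cobase_subgroup mK.1; have sN' := cobase_subgroup mK'.1.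
have [//|qN] := maximal_cogroup_exponent mK sN'; exfalso; apply: nepi.
(* Unbounded order in [X / cobase K] makes [cobase K'] surject onto that quotient. *)
have sum y : exists2 x, cobase K' x & cobase K (y - x).
  have [j Nj] := maximal_cogroup_2power mK y; have [x N'x Kx] := qN j.
  have [|m Nm] := maximal_cogroup_cyclic mK Kx (y := y).
    by rewrite expnSr mulrnA; exact: subgroupMn.
  by exists (x *+ m) => //; exact: subgroupMn.
have [f [fN fs]] := cogroup_epimorphism R mK qK.
have [g [gN gs]] := cogroup_epimorphism R mK' qK'.
pose F x := (f x, g x).
have FB : {morph F : x y / x - y} by move=> x y; rewrite /F !raddfB.
pose FF : {additive X -> quasicyclic2 R * quasicyclic2 R} :=
  HB.pack F (GRing.isZmodMorphism.Build _ _ F FB).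
exists FF => -[u v] _.
(* Chinese remaindering: [b + x] is congruent to [a] modulo [cobase K] and to [b] modulo
   [cobase K']. *)
have [a aE] := fs u; have [b bE] := gs v; have [x N'x Nx] := sum (a - b).
exists (b + x) => //; rewrite /= /F; congr (_, _).
  have -> : b + x = a - (a - b - x) by zmod.
  by rewrite raddfB /= (fN (a - b - x)).2 // subr0.
by rewrite raddfD /= (gN x).2 // addr0.
Qed.

(** * Counting maximal 2-cogroups *)

Section Counting.
Variables (X : zmodType) (s s2 : seq X).
Hypothesis torsX : forall x, exists2 q, (0 < q)%N & zspan s (x *+ q).
Hypothesis twoX : forall x, x *+ 2 = 0 -> x \in s2.
Implicit Types (K U : set X) (x y z u w : X).

Let sS : subgroup (zspan s) := span_subgroup s.

Definition span_pow n : set X := [set x | exists2 y, zspan s y & x = y *+ (2 ^ n)%N].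

Lemma span_pow_subgroup n : subgroup (span_pow n).
Proof.
apply/subgroupP; split; first by exists 0; [exact: subgroup0|rewrite mul0rn].
move=> _ _ [y sy ->] [z sz ->]; exists (y - z); last by rewrite mulrnBl.
exact: subgroupB.
Qed.

(** If [x *+ 2] is [y *+ 2 ^ n.+1], then [x] differs from [y *+ 2 ^ n] by one of the finitely many
    elements killed by 2, and [y] matters only modulo doubles; the exponent [n.+1] permits this
    halving. *)
Lemma span_pow_finite_mod n k :
  finite_mod (span_pow n.+1) [set x | span_pow n.+1 (x *+ (2 ^ k)%N)].
Proof.
apply: finite_mod_halves; first exact: span_pow_subgroup.
have [l hl] := span_halves s.
exists [seq t + y *+ (2 ^ n)%N | t <- s2, y <- l] => x [y sy x2].
have [y0 [z [yl sz yE]]] := hl y sy.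
have /twoX t2 : (x - y *+ (2 ^ n)%N) *+ 2 = 0.
  by rewrite mulrnBl x2 -mulrnA -expnSr subrr.
exists (x - y *+ (2 ^ n)%N + y0 *+ (2 ^ n)%N).
  by apply/allpairsP; exists (x - y *+ (2 ^ n)%N, y0).
exists z => //; rewrite {1}yE mulrnDl -mulrnA -expnS.
by set b := z *+ _; set a := y0 *+ _; zmod.
Qed.

(** The preimage of the 2-primary component of [X / zspan s]; every element of [X] has an odd
    multiple in it. *)
Definition span_2closure : set X := [set x | exists k, zspan s (x *+ (2 ^ k)%N)].

Lemma span_2closure_subgroup : subgroup span_2closure.
Proof.
apply/subgroupP; split; first by exists 0%N; rewrite mul0rn; exact: subgroup0.
move=> x y [k xk] [l yl]; exists (k + l)%N; rewrite mulrnBl.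
apply: subgroupB => //; first by rewrite expnD mulrnA; exact: subgroupMn.
by rewrite addnC expnD mulrnA; exact: subgroupMn.
Qed.

(** * Stabilization of a decreasing chain of subgroups *)

Section Stabilization.
Variables (n : nat) (U : set X).
Hypothesis sU : subgroup U.
Let W := span_pow n.+1.
Let sW : subgroup W := span_pow_subgroup n.+1.
Let D := span_2closure.
Let sD : subgroup D := span_2closure_subgroup.

Definition multiples k : set X :=
  [set x | exists u w, [/\ U u, D u, W w & x = u *+ (2 ^ k)%N + w]].

Lemma multiples_subgroup k : subgroup (multiples k).
Proof.
apply/subgroupP; split.
  by exists 0, 0; split; rewrite ?mul0rn ?addr0 //; exact: subgroup0.
move=> _ _ [u [w [Uu Du Ww ->]]] [v [t [Uv Dv Wt ->]]].
exists (u - v), (w - t); split; try exact: subgroupB.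
by rewrite mulrnBl; zmod.
Qed.

Lemma span_pow_multiples k : W `<=` multiples k.
Proof.
by move=> w Ww; exists 0, w; split; rewrite ?mul0rn ?add0r //; exact: subgroup0.
Qed.

Lemma multiples_decreasing k l : (k <= l)%N -> multiples l `<=` multiples k.
Proof.
move=> kl _ [u [w [Uu Du Ww ->]]]; exists (u *+ (2 ^ (l - k))%N), w.
split=> //; try exact: subgroupMn.
by rewrite -mulrnA -expnD subnK.
Qed.

Lemma span_2closureP x : D x -> exists k, W (x *+ (2 ^ k)%N).
Proof. by move=> [k sx]; exists (k + n.+1)%N, (x *+ (2 ^ k)%N); rewrite // expnD mulrnA. Qed.

(** Only finitely many classes modulo [W] are killed by 2; [k0] lies beyond the stage at which each
    nonpersistent one has left the chain. *)
Lemma multiples_stable : exists k0, forall x, W (x *+ 2) -> multiples k0 x ->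
  forall k, multiples k x.
Proof.
have [l hl] := span_pow_finite_mod n 1.
have [k0 hk0] : exists k0, forall y, y \in l -> multiples k0 y -> forall k, multiples k y.
  elim: l {hl} => [|y l [k0 hk0]]; first by exists 0%N.
  have [Py|/existsNP[k1 nk1]] := pselect (forall k, multiples k y).
    by exists k0 => z; rewrite inE => /predU1P[->//|]; exact: hk0.
  exists (maxn k0 k1) => z; rewrite inE => /predU1P[->|zl] Pz.
    by exfalso; apply: nk1; apply: multiples_decreasing Pz; rewrite leq_maxr.
  by apply: hk0 => //; apply: multiples_decreasing Pz; rewrite leq_maxl.
exists k0 => x W2x Px k; have [y yl Wxy] := hl x W2x.
have sP j := multiples_subgroup j.
apply/(subgroupDl _ (sP k) (span_pow_multiples k (subgroupN sW Wxy))).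
rewrite opprB subrK; apply: hk0 => //.
by rewrite -(subKr x y); apply: subgroupB => //; exact: span_pow_multiples.
Qed.

(** The groups [multiples k], taken modulo [W], decrease to a 2-divisible
    group, which is reached after finitely many steps. *)
Lemma multiples_finite_mod i : finite_mod (multiples i) (U `&` D).
Proof.
have [k0 hk0] := multiples_stable.
have sP j := multiples_subgroup j.
have div m x : W (x *+ (2 ^ m)%N) -> multiples k0 x ->
    forall k, (k0 <= k)%N -> multiples k x.
  elim: m x => [|m IH] x; first by rewrite mulr1n => Wx _ k _; exact: span_pow_multiples.
  rewrite expnSr mulrnA => Wx Px k k0k.
  (* Precision [k + m] lets [u *+ 2 ^ k] be subtracted from [x], leaving a remainder killed by
     [2 ^ m] modulo [W]. *)
  have [u [w [Uu Du Ww E]]] := hk0 _ Wx (subgroupMn _ (sP k0) Px) (k + m)%N.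
  have Pu : multiples k (u *+ (2 ^ k)%N).
    by exists u, 0; split; rewrite ?addr0 //; exact: subgroup0.
  rewrite -(subrK (u *+ (2 ^ k)%N) x); apply: subgroupD => //.
  apply: IH => //; last by apply: subgroupB => //; exact: multiples_decreasing Pu.
  by rewrite mulrnBl E -mulrnA -expnD addrAC subrr add0r.
have [l hl] := span_pow_finite_mod n k0.
exists l => u [Uu Du].
have Pu : multiples k0 (u *+ (2 ^ k0)%N).
  by exists u, 0; split; rewrite ?addr0 //; exact: subgroup0.
have [m Wm] := span_2closureP Du.
have Wm' : W (u *+ (2 ^ k0)%N *+ (2 ^ m)%N) by rewrite mulrnAC; exact: subgroupMn.
(* With exponent [i + k0], the difference [u - v *+ 2 ^ i] is killed by [2 ^ k0] modulo [W], so it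
   has finitely many possible classes. *)
have [v [w [Uv Dv Ww E]]] := div m _ Wm' Pu (i + k0)%N (leq_addl _ _).
have /hl[y yl Wy] : W ((u - v *+ (2 ^ i)%N) *+ (2 ^ k0)%N).
  by rewrite mulrnBl E -mulrnA -expnD addrAC subrr add0r.
exists y => //; exists v, (u - v *+ (2 ^ i)%N - y); split=> //.
by zmod.
Qed.

(** The base contains [multiples i] and meets [D] inside [U], so its trace on [D] is decided by
    finitely many representatives. Odd multiples then determine the base, and the base determines
    [K]. *)
Lemma countable_sandwiched i : countable [set K |
  [/\ maximal_two_cogroups K, W `<=` cobase K,
      forall u, U u -> D u -> cobase K (u *+ (2 ^ i)%N)
    & forall x, cobase K x -> D x -> U x]].
Proof.
set F := [set K | _]; have [l hl] := multiples_finite_mod i.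
pose f K := pickle [seq `[< cobase K y >] | y <- l].
apply/countable_injP; exists f => K K'; rewrite !inE => FK FK' /(pcan_inj pickleK) E.
have {}E y : y \in l -> cobase K y <-> cobase K' y.
  move=> yl; apply: asbool_eq_equiv; move/eq_in_map: E; exact.
have sub L L' : F L -> F L' -> (forall y, y \in l -> cobase L y <-> cobase L' y) ->
    cobase L `<=` cobase L'.
  move=> [mL WL iL UL] [mL' WL' iL' UL'] LL' x Lx.
  have sL := cobase_subgroup mL.1; have sL' := cobase_subgroup mL'.1.
  have [q q0 sxq] := torsX x.
  have [|r] := @pfactor_coprime 2 q _ q0; first by [].
  rewrite coprime2n => odr; set a := logn 2 q => qE.
  apply: (maximal_cogroup_odd mL' odr).
  have Dx : D (x *+ r) by exists a; rewrite -mulrnA -qE.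
  have Lxr : cobase L (x *+ r) by exact: subgroupMn.
  have [y yl Pxy] := hl _ (conj (UL _ Lxr Dx) Dx).
  have PL M : F M -> multiples i `<=` cobase M.
    move=> [mM WM iM UM] _ [u [w [Uu Du Ww ->]]].
    by apply: (subgroupD (cobase_subgroup mM.1)); [exact: iM|exact: WM].
  rewrite -(subrK y (x *+ r)); apply: subgroupD => //; first exact: PL Pxy.
  apply: (LL' y yl).1; rewrite -(subKr (x *+ r) y); apply: subgroupB => //.
  exact: PL Pxy.
have N : cobase K = cobase K'.
  by rewrite eqEsubset; split; apply: sub => // y yl; split=> h; apply/(E y yl).
have half L L' : F L -> F L' -> cobase L = cobase L' -> L `<=` L'.
  move=> [mL _ _ _] [mL' _ _ _] LL' a La.
  have [|L'a|//] := maximal_cogroup_halves mL' (x := a).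
    by rewrite -LL'; exact: cobase_dbl La.
  by exfalso; apply: (cobaseF mL.1 _ La); rewrite LL'.
by rewrite eqEsubset; split; apply: half.
Qed.

End Stabilization.

Lemma span_pow_cobase K : maximal_two_cogroups K ->
  exists n, span_pow n.+1 `<=` cobase K.
Proof.
move=> mK; have sN := cobase_subgroup mK.1.
suff [n hn] : exists n, forall y, zspan s y -> cobase K (y *+ (2 ^ n)%N).
  exists n => _ [y sy ->]; rewrite expnSr mulrnA; apply: subgroupMn => //.
  exact: hn.
elim: (s) => [|a l [n hn]].
  by exists 0%N => y ->; rewrite mul0rn; exact: subgroup0.
have [k Nk] := maximal_cogroup_2power mK a.
exists (n + k)%N => y [m /hn Ny].
rewrite -[y](subrK (a *~ m)) mulrnDl; apply: subgroupD => //.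
  by rewrite expnD mulrnA; exact: subgroupMn.
rewrite addnC expnD mulrnA; apply: subgroupMn => //.
by rewrite pmulrn -mulrzA mulrC mulrzA -pmulrn; exact: subgroupMz.
Qed.

End Counting.

Lemma rank_countable_cogroups (R : realType) (X : zmodType) :
  ~ (exists f : {additive X -> quasicyclic2 R * quasicyclic2 R},
       set_surj setT setT f) ->
  finite_free_rank X -> finite_two_rank X ->
  countable (@maximal_two_cogroups X).
Proof.
move=> nepi /free_rank_torsion[s torsX] /two_rank_finite[s2 twoX].
pose quasi (K : set X) := forall j, exists x, K (x *+ (2 ^ j)%N).
pose F n i (U : set X) := [set K |
  [/\ maximal_two_cogroups K, span_pow s n.+1 `<=` cobase K,
      forall u, U u -> span_2closure s u -> cobase K (u *+ (2 ^ i)%N)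
    & forall x, cobase K x -> span_2closure s x -> U x]].
have cF n i U : subgroup U -> countable (F n i U).
  by move=> sU; exact: (countable_sandwiched torsX twoX).
have sT : subgroup [set: X] by apply/subgroupP; split.
pose V (K : set X) k := [set x | cobase K (x *+ (2 ^ k)%N)].
have sV K k : maximal_two_cogroups K -> subgroup (V K k).
  move=> [cK _]; have sN := cobase_subgroup cK; apply/subgroupP; rewrite /V /=.
  split; first by rewrite mul0rn; exact: subgroup0.
  by move=> x y Nx Ny; rewrite mulrnBl; exact: subgroupB.
(* Bounded quotients are covered with [U = setT]; the quasicyclic ones are compared with one fixed
   [K0], if there is any. *)
have [K0 cover] : exists K0 : set X, @maximal_two_cogroups X `<=`
    \bigcup_n \bigcup_i F n i setT `|`
    \bigcup_n \bigcup_i [set K | maximal_two_cogroups K0 /\ F n (i + i)%N (V K0 i) K].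
  have nq K : maximal_two_cogroups K -> ~ quasi K ->
      (\bigcup_n \bigcup_i F n i setT) K.
    move=> mK nqK; have [n Wn] := span_pow_cobase s mK.
    have [[i hi]|qK] := maximal_cogroup_exponent mK sT.
      by exists n => //; exists i => //; split=> // u _ _; exact: hi.
    by exfalso; apply: nqK => j; have [x _ Kx] := qK j; exists x.
  have [[K0 [mK0 qK0]]|nK0] := pselect (exists K, maximal_two_cogroups K /\ quasi K).
    exists K0 => K mK; have [qK|/(nq _ mK)] := pselect (quasi K); last by left.
    right; have [n Wn] := span_pow_cobase s mK; exists n => //.
    have [k hk] := cogroups_commensurable nepi mK mK0 qK qK0.
    have [l hl] := cogroups_commensurable nepi mK0 mK qK0 qK.
    have sN := cobase_subgroup mK.1; have sN0 := cobase_subgroup mK0.1.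
    (* Modulo the base of [K], passing from [V K0 (k + l)] costs the factor [2 ^ (k + l)] to reach
       the base of [K0] and then [2 ^ k]; hence the exponent [i + i]. *)
    exists (k + l)%N => //; split=> //; split=> // [u Vu _|x Nx _].
      have := hk _ Vu; rewrite -mulrnA -expnD => Nu.
      by rewrite addnA expnD mulrnA; exact: subgroupMn.
    by rewrite /V /= addnC expnD mulrnA; apply: subgroupMn => //; exact: hl.
  exists set0 => K mK; left; apply: nq => // qK; apply: nK0.
  by exists K.
apply: sub_countable (subset_card_le cover) _.
rewrite -bigcup2E; apply: bigcup_countable => // -[|[|j]] _ /=.
- by apply: bigcup_countable => // n _; apply: bigcup_countable => // i _; exact: cF.
- apply: bigcup_countable => // n _; apply: bigcup_countable => // i _.
  have [mK0|nK0] := pselect (maximal_two_cogroups K0).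
    by apply: sub_countable (cF n (i + i)%N _ (sV K0 i mK0)); apply: subset_card_le => K [].
  by apply: sub_countable (@countable0 (set X)); apply: subset_card_le => K [].
- exact: (@countable0 (set X)).
Qed.

Theorem theorem19p4 (R : realType) (X : zmodType) :
  [<-> forall I : set (PPX X),
         minimal_left_ideal (@superextension X) (@circ X) I ->
         metrizable R (set_type I);
       countable (@maximal_two_cogroups X);
       [/\ ~ (exists f : {additive X -> quasicyclic2 R * quasicyclic2 R},
                set_surj setT setT f),
           finite_free_rank X
         & finite_two_rank X] ].
Proof.
tfae.
- exact: countable_maximal_cogroups.
- exact: countable_cogroups_rank.
- move=> [nepi r0 r2]; apply: metrizable_minimal_left_ideal.
  exact: (rank_countable_cogroups nepi).
Qed.
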